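(* Let $F\in C^\infty(\overline{\Omega_r})$ be such that for every $s$ the restriction of $F$ to the circle $C_s=\{x:|x-\gamma(s)|=r\}$ coincides with the restriction to $C_s$ of a polynomial in two variables of degree at most $N$. Then $F$ is a polynomial function in the variables $(x_1,x_2)$ of degree at most $2N$.
   Context: $\gamma$ is a smooth simple closed curve in $\mathbb{R}^2$ parametrized by arc length $s$, $n=J\dot\gamma$ with $J$ the counterclockwise rotation by $\pi/2$, and $\gamma_t=\gamma+t\,n$ is the parallel curve. $r_0$ is the largest radius for which the tubular neighbourhood of $\gamma$ is diffeomorphic to its normal bundle, and $r>0$ satisfies $r<r_0/2$. $\Omega_r$ is the annulus bounded by $\gamma_{+r}$ and $\gamma_{-r}$, i.e. the set of centers of circles of radius $r$ intersecting $\gamma$; $\overline{\Omega_r}$ is the union of the circles $C_s$. *)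

(* Defs.v *)
From HB Require Import structures.
From mathcomp Require Import all_boot all_order all_algebra.
From mathcomp Require Import all_classical all_reals all_analysis.
Set Implicit Arguments. Unset Strict Implicit. Unset Printing Implicit Defensive.
Import Order.TTheory GRing.Theory Num.Theory.
Import numFieldNormedType.Exports.
Local Open Scope classical_set_scope.
Local Open Scope ring_scope.

Section Defs.
Variable R : realType.

Definition smooth1 (f : R -> R) : Prop :=
  forall (n : nat) (x : R), derivable (derive1n n f) x 1.

Definition dir (b : bool) : R * R := if b then (1, 0) else (0, 1).

Definition pderivs (ds : seq bool) (F : R * R -> R) : R * R -> R :=
  foldr (fun d G => fun x => derive G x (dir d)) F ds.

(* F in C^infinity(closure of O), O open with closure K:
   all iterated partial derivatives exist on O and extend continuously to K,
   and F itself is continuous on K (i.e. F on K is the continuous extension). *)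
Definition smooth_upto (O K : set (R * R)) (F : R * R -> R) : Prop :=
  {within K, continuous F} /\
  forall ds : seq bool,
    (forall x, O x -> forall d, derivable (pderivs ds F) x (dir d)) /\
    (exists G : R * R -> R,
        {within K, continuous G} /\ forall x, O x -> G x = pderivs ds F x).

Definition poly2_le (N : nat) (P : R -> R -> R) : Prop :=
  exists c : nat -> nat -> R, forall x1 x2 : R,
    P x1 x2 = \sum_(i < N.+1) \sum_(j < N.+1 | (i + j <= N)%N)
                 c i j * x1 ^+ i * x2 ^+ j.

Definition arclength_simple_closed (g1 g2 : R -> R) (L : R) : Prop :=
  [/\ 0 < L, smooth1 g1 /\ smooth1 g2,
      (forall s, g1 (s + L) = g1 s /\ g2 (s + L) = g2 s),
      (forall s s', 0 <= s < L -> 0 <= s' < L ->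
          g1 s = g1 s' -> g2 s = g2 s' -> s = s') &
      (forall s, (derive1 g1 s) ^+ 2 + (derive1 g2 s) ^+ 2 = 1)].

(* normal n = J gamma' = (-g2', g1');  parallel curve gamma_t = gamma + t n *)
Definition tube (g1 g2 : R -> R) (s t : R) : R * R :=
  (g1 s - t * derive1 g2 s, g2 s + t * derive1 g1 s).

(* signed curvature kappa = gamma'' . n ; Jacobian of (s,t) |-> tube s t
   is 1 - t kappa(s) *)
Definition curvature (g1 g2 : R -> R) (s : R) : R :=
  derive1 g1 s * derive1 (derive1 g2) s - derive1 g2 s * derive1 (derive1 g1) s.

(* the tubular neighbourhood of radius rho is diffeomorphic to the normal
   bundle via (s,t) |-> gamma(s) + t n(s): injective immersion on
   [0,L) x (-rho, rho) *)
Definition tube_ok (g1 g2 : R -> R) (L rho : R) : Prop :=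
  (forall s s' t t', 0 <= s < L -> 0 <= s' < L -> `|t| < rho -> `|t'| < rho ->
      tube g1 g2 s t = tube g1 g2 s' t' -> s = s' /\ t = t') /\
  (forall s t, `|t| < rho -> 1 - t * curvature g1 g2 s != 0).

Definition circ (g1 g2 : R -> R) (r s : R) : set (R * R) :=
  [set x | (x.1 - g1 s) ^+ 2 + (x.2 - g2 s) ^+ 2 = r ^+ 2].

Definition Omega_bar (g1 g2 : R -> R) (r : R) : set (R * R) :=
  [set x | exists s, circ g1 g2 r s x].

Definition Omega (g1 g2 : R -> R) (r : R) : set (R * R) :=
  [set x | exists s t, `|t| < r /\ x = tube g1 g2 s t].

End Defs.

(* Main.v *)
(* Restricted to the circle of radius r centred at gamma(s), parametrized by
   gamma(s) + r w with |w| = 1, F is a Laurent polynomial in w with exponents in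
   [-N, N]. Differentiating in s and along the circle expresses dF/dz and
   dF/dzbar there as Laurent polynomials divided by e + conj(e) w^2, where
   e = gamma'(s). The zeros of this divisor are the points where the circle
   touches the boundary of the annulus; as the derivatives of F stay bounded
   there, the numerators vanish too and the division is exact. Counting
   exponents, d/dz deletes the top exponent and d/dzbar the bottom one. Since
   only 2N + 1 exponents are present at the start, all derivatives of order
   2N + 1 vanish, and F is a polynomial of degree at most 2N on each disc
   |x - gamma(s)| < r. These discs cover the annulus and the polynomials of
   neighbouring discs agree. *)
Require Import Defs.
From HB Require Import structures.
From mathcomp Require Import all_boot all_order all_algebra.
From mathcomp Require Import all_classical all_reals all_analysis.
From mathcomp Require Import ring lra zify.
From mathcomp.real_closed Require Import complex.
Set Implicit Arguments.
Unset Strict Implicit.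
Unset Printing Implicit Defensive.
Import Order.TTheory GRing.Theory Num.Theory.
Import numFieldNormedType.Exports.
Local Open Scope classical_set_scope.
Local Open Scope ring_scope.

Local Notation Re := complex.Re.
Local Notation Im := complex.Im.

(** * Polynomials in two variables *)

(** The hypothesis provides one polynomial per [s], with no regularity in [s], and the derivatives
    of [F] exist on the open annulus only. Identities on a circle are therefore stated off its two
    points of contact with the boundary, which are reached by limits alone. Each step solves a 2 by
    2 linear system for dF/dz and dF/dzbar, given by the derivatives along the family and along the
    circle; up to a unit factor, its determinant is the divisor. These derivatives are complex even
    for real [F], so the induction runs over pairs of real functions. It ends with functions known
    to vanish at the non-contact points of the circles; the tubular neighbourhood ensures that these
    points fill the open annulus. Degrees are bounded strictly, so that the bound 0 means the zero
    function and each integration adds exactly one. *)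

Definition poly2_lt (R : realType) (n : nat) (P : R -> R -> R) : Prop :=
  exists c : nat -> nat -> R, forall x y : R,
    P x y = \sum_(i < n) \sum_(j < n | (i + j < n)%N) c i j * x ^+ i * y ^+ j.

Section Poly2.
Variable R : realType.
Implicit Types (P Q : R -> R -> R) (n : nat).

Lemma eq_poly2 n P Q : (forall x y, P x y = Q x y) ->
  poly2_lt n P -> poly2_lt n Q.
Proof. by move=> PQ [c Pc]; exists c => x y; rewrite -PQ. Qed.

Lemma poly2_ltD n P Q : poly2_lt n P -> poly2_lt n Q ->
  poly2_lt n (fun x y => P x y + Q x y).
Proof.
move=> [c Pc] [d Qd]; exists (fun i j => c i j + d i j) => x y.
rewrite Pc Qd -big_split; apply: eq_bigr => i _ /=; rewrite -big_split.
by apply: eq_bigr => j _ /=; rewrite !mulrDl.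
Qed.

Lemma poly2_ltN n P : poly2_lt n P -> poly2_lt n (fun x y => - P x y).
Proof.
move=> [c Pc]; exists (fun i j => - c i j) => x y.
rewrite Pc -sumrN; apply: eq_bigr => i _; rewrite -sumrN.
by apply: eq_bigr => j _; rewrite !mulNr.
Qed.

Lemma poly2_lt_0 n : poly2_lt n (fun _ _ : R => 0).
Proof.
exists (fun _ _ => 0) => x y; rewrite big1 // => i _.
by rewrite big1 // => j _; rewrite !mul0r.
Qed.

Lemma poly2_lt_sum n (I : Type) (r : seq I) (p : pred I)
    (F : I -> R -> R -> R) : (forall i, p i -> poly2_lt n (F i)) ->
  poly2_lt n (fun x y => \sum_(i <- r | p i) F i x y).
Proof.
move=> F_n; elim: r => [|i r IH].
  by apply: eq_poly2 (poly2_lt_0 n) => x y; rewrite big_nil.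
case pi: (p i).
  apply: eq_poly2 (poly2_ltD (F_n i pi) IH) => x y.
  by rewrite big_cons pi.
by apply: eq_poly2 IH => x y; rewrite big_cons pi.
Qed.

Lemma poly2_lt_monomial n (a : R) (i j : nat) : (i + j < n)%N ->
  poly2_lt n (fun x y => a * x ^+ i * y ^+ j).
Proof.
move=> ijn; exists (fun i' j' => if (i' == i) && (j' == j) then a else 0).
have ltin : (i < n)%N by apply: leq_ltn_trans ijn; rewrite leq_addr.
have ltjn : (j < n)%N by apply: leq_ltn_trans ijn; rewrite leq_addl.
move=> x y; rewrite (bigD1 (Ordinal ltin)) //= (bigD1 (Ordinal ltjn)) //=.
rewrite !eqxx big1 ?addr0 => [|k /andP[_ /negPf kj]]; last first.
  by rewrite -[_ == _ :> nat]/(k == Ordinal ltjn) kj andbF !mul0r.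
rewrite big1 ?addr0 // => k /negPf ki; rewrite big1 // => l _.
by rewrite -[k == i :> nat]/(k == Ordinal ltin) ki !mul0r.
Qed.

Lemma poly2_lt_cst n (a : R) : poly2_lt n.+1 (fun _ _ => a).
Proof.
have := @poly2_lt_monomial n.+1 a 0 0 isT.
by apply: eq_poly2 => x y; rewrite !expr0 !mulr1.
Qed.

Lemma poly2_lt_substx n P (a : R) : poly2_lt n P ->
  poly2_lt n (fun _ y => P a y).
Proof.
move=> [c Pc]; apply: (@eq_poly2 n (fun x y =>
  \sum_(i < n) \sum_(j < n | (i + j < n)%N) (c i j * a ^+ i) * x ^+ 0 * y ^+ j)).
  by move=> x y; rewrite Pc; do 2![apply: eq_bigr => ? _]; rewrite expr0 mulr1.
apply: poly2_lt_sum => i _; apply: poly2_lt_sum => j ij.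
by apply: poly2_lt_monomial; apply: leq_ltn_trans ij; rewrite leq_addl.
Qed.

Lemma is_derive_bigsum (I : Type) (r : seq I) (p : pred I)
    (f : I -> R -> R) (df : I -> R) (x : R) :
  (forall i, p i -> is_derive x 1 (f i) (df i)) ->
  is_derive x 1 (fun t => \sum_(i <- r | p i) f i t) (\sum_(i <- r | p i) df i).
Proof.
move=> fdf; elim: r => [|i r IH].
  rewrite big_nil; under eq_fun do rewrite big_nil.
  exact: (is_derive_cst (0 : R) x 1).
rewrite big_cons; under eq_fun do rewrite big_cons.
by case: ifP => // pi; apply: is_deriveD; exact: fdf.
Qed.

Lemma is_derive_shift_exp (a x : R) (i : nat) :
  is_derive x 1 (fun t => a / i.+1%:R * t ^+ i.+1) (a * x ^+ i).
Proof.
have -> : (fun t => a / i.+1%:R * t ^+ i.+1) = (a / i.+1%:R) \*: (id ^+ i.+1).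
  by apply/funext => t; rewrite /= exprfctE.
apply: is_derive_eq.
rewrite /GRing.scale /= mulr1 mulrA; congr (_ * _).
by rewrite -mulrA mulVf ?mulr1 // pnatr_eq0.
Qed.

Lemma is_deriveMcst (f : R -> R) (x df k : R) : is_derive x 1 f df ->
  is_derive x 1 (fun t => f t * k) (df * k).
Proof.
move=> fdf; have -> : (fun t => f t * k) = k \*: f.
  by apply/funext => t /=; rewrite mulrC.
by rewrite mulrC; apply: is_deriveZ.
Qed.

Lemma poly2_lt_primitivex n P : poly2_lt n P -> exists Q,
  poly2_lt n.+1 Q /\ forall x y : R, is_derive x 1 (fun t => Q t y) (P x y).
Proof.
move=> [c Pc]; exists (fun x y => \sum_(i < n) \sum_(j < n | (i + j < n)%N)
  c i j / i.+1%:R * x ^+ i.+1 * y ^+ j); split.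
  apply: poly2_lt_sum => i _; apply: poly2_lt_sum => j ij.
  by apply: poly2_lt_monomial; rewrite addSn ltnS.
move=> x y; rewrite Pc; apply: is_derive_bigsum => i _.
apply: is_derive_bigsum => j _.
exact/is_deriveMcst/is_derive_shift_exp.
Qed.

Lemma poly2_lt_swap n P : poly2_lt n P -> poly2_lt n (fun x y => P y x).
Proof.
move=> [c Pc]; apply: (@eq_poly2 n (fun x y =>
  \sum_(i < n) \sum_(j < n | (i + j < n)%N) c i j * x ^+ j * y ^+ i)).
  by move=> x y; rewrite Pc; do 2![apply: eq_bigr => ? _]; rewrite mulrAC.
apply: poly2_lt_sum => i _; apply: poly2_lt_sum => j ij.
by apply: poly2_lt_monomial; rewrite addnC.
Qed.

Lemma poly2_lt_primitivey n P : poly2_lt n P -> exists Q,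
  poly2_lt n.+1 Q /\ forall x y : R, is_derive y 1 (Q x) (P x y).
Proof.
move=> /poly2_lt_swap/poly2_lt_primitivex [Q [Qn dQ]].
by exists (fun x y => Q y x); split => // ; apply: poly2_lt_swap.
Qed.

Lemma poly2_lt_hornerx n P (y : R) : poly2_lt n P ->
  exists p : {poly R}, forall x, P x y = p.[x].
Proof.
move=> [c Pc]; exists (\sum_(i < n) \sum_(j < n | (i + j < n)%N)
  (c i j * y ^+ j) *: 'X^i) => x.
rewrite Pc horner_sum; apply: eq_bigr => i _; rewrite horner_sum.
by apply: eq_bigr => j _; rewrite hornerZ hornerXn mulrAC.
Qed.

Lemma poly_eq0_near (p : {poly R}) (a e : R) : 0 < e ->
  (forall x, `|x - a| < e -> p.[x] = 0) -> p = 0.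
Proof.
move=> e0 p0; apply/eqP/negPn/negP => pN0.
(* Infinitely many distinct points near [a]; denominators start at 2 because the distance must stay
   strictly below [e]. *)
pose u k : R := a + e / k.+2%:R.
have uinj : injective u.
  move=> k l /addrI /(mulfI (lt0r_neq0 e0)) /invr_inj /eqP.
  by rewrite eqr_nat => /eqP [].
have /(_ (map u (iota 0 (size p)))) := max_poly_roots pN0.
rewrite size_map size_iota ltnn map_inj_uniq ?iota_uniq // => /(_ _ isT) H.
suff : false by []; apply: H; apply/allP => _ /mapP[k _ ->].
apply/eqP/p0; rewrite /u addrAC subrr add0r normrM gtr0_norm //.
rewrite gtr0_norm ?invr_gt0 ?ltr0n // gtr_pMr // invf_lt1 ?ltr0n //.
by rewrite ltr1n.
Qed.

(** One-variable polynomials with infinitely many roots vanish; this is applied in each variable in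
    turn. It serves to identify the polynomials of overlapping discs. *)
Lemma poly2_lt_eq0 n P (a b e : R) : poly2_lt n P -> 0 < e ->
  (forall x y, `|x - a| < e -> `|y - b| < e -> P x y = 0) ->
  forall x y, P x y = 0.
Proof.
move=> Pn e0 P0 x y.
have Py x' y' : `|y' - b| < e -> P x' y' = 0.
  move=> yb; have [p Pp] := poly2_lt_hornerx y' Pn.
  rewrite Pp (@poly_eq0_near p a e) ?horner0 // => z za.
  by rewrite -Pp P0.
have [p Pp] := poly2_lt_hornerx x (poly2_lt_swap Pn).
rewrite Pp (@poly_eq0_near p b e) ?horner0 // => z zb.
by rewrite -Pp Py.
Qed.

End Poly2.

(** * Calculus in the plane *)

Section Calculus.
Variable R : realType.

Lemma is_derive_slicex (f : R * R -> R) (a b l : R) :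
  is_derive (a, b) (1, 0) f l <-> is_derive a 1 (fun t => f (t, b)) l.
Proof.
have E : (fun h : R => h^-1 *: ((f \o shift (a, b)) (h *: (1, 0)) - f (a, b))) =
    (fun h : R => h^-1 *: (((fun t => f (t, b)) \o shift a) (h *: 1) - f (a, b))).
  apply/funext => h /=; congr (_ *: (f _ - _)).
  by apply/pair_equal_spec; split=> //=; rewrite scaler0 add0r.
by split => -[D V]; split; rewrite /derivable /derive ?E -?E // in D V *.
Qed.

Lemma is_derive_slicey (f : R * R -> R) (a b l : R) :
  is_derive (a, b) (0, 1) f l <-> is_derive b 1 (fun t => f (a, t)) l.
Proof.
have E : (fun h : R => h^-1 *: ((f \o shift (a, b)) (h *: (0, 1)) - f (a, b))) =
    (fun h : R => h^-1 *: (((fun t => f (a, t)) \o shift b) (h *: 1) - f (a, b))).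
  apply/funext => h /=; congr (_ *: (f _ - _)).
  by apply/pair_equal_spec; split=> //=; rewrite scaler0 add0r.
by split => -[D V]; split; rewrite /derivable /derive ?E -?E // in D V *.
Qed.

Lemma is_derive_continuous (f : R -> R) (x l : R) :
  is_derive x 1 f l -> {for x, continuous f}.
Proof. by move=> [D _]; apply/differentiable_continuous/derivable1_diffP. Qed.

Lemma is_derive_addcst (f : R -> R) (x l k : R) :
  is_derive x 1 f l -> is_derive x 1 (fun t => f t + k) l.
Proof.
move=> fl; have H := is_derive_cst k x (1 : R).
by apply: is_derive_eq (is_deriveD fl H) _; rewrite addr0.
Qed.

Lemma is_derive_cstMadd (f : R -> R) (x l k c : R) :
  is_derive x 1 f l -> is_derive x 1 (fun t => k + c * f t) (c * l).
Proof.
move=> fl; have H := is_derive_cst k x (1 : R).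
by apply: is_derive_eq (is_deriveD H (is_deriveZ c fl)) _; rewrite add0r.
Qed.

(** No order between [a] and [b] is assumed; the symmetric interval around [a] matches boxes and
    discs centred there. *)
Lemma mean_value_center (f df : R -> R) (a b : R) :
  (forall x, `|x - a| <= `|b - a| -> is_derive x 1 f (df x)) ->
  exists c, `|c - a| <= `|b - a| /\ f b - f a = df c * (b - a).
Proof.
move=> fdf.
have [ab|ba] := leP a b.
  have bE : `|b - a| = b - a by rewrite ger0_norm // subr_ge0.
  have H x : x \in `[a, b] -> `|x - a| <= `|b - a|.
    rewrite in_itv /= => /andP[ax xb].
    by rewrite ger0_norm ?subr_ge0 // bE lerB.
  have [||c cab ->] := @MVT_segment R f df a b ab.
  - by move=> x /subset_itv_oo_cc/H/fdf.
  - by apply: derivable_within_continuous => x /H /fdf [].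
  exists c; split=> //; move: cab; rewrite in_itv /= => /andP[ac cb].
  by rewrite ger0_norm ?subr_ge0 // bE lerB.
have bE : `|b - a| = a - b by rewrite distrC ger0_norm // subr_ge0 ltW.
have H x : x \in `[b, a] -> `|x - a| <= `|b - a|.
  rewrite in_itv /= => /andP[bx xa].
  by rewrite distrC ger0_norm ?subr_ge0 // bE lerB.
have [||c cab E] := @MVT_segment R f df b a (ltW ba).
- by move=> x /subset_itv_oo_cc/H/fdf.
- by apply: derivable_within_continuous => x /H /fdf [].
exists c; split; last by rewrite -opprB E -mulrN opprB.
move: cab; rewrite in_itv /= => /andP[bc ca].
by rewrite distrC ger0_norm ?subr_ge0 // bE lerB.
Qed.

Lemma near_pairP (x : R * R) (P : R * R -> Prop) :
  (\forall y \near x, P y) <->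
  exists2 e : R, 0 < e & forall y, `|y.1 - x.1| < e -> `|y.2 - x.2| < e -> P y.
Proof.
split=> [/nbhs_ballP [e /= e0 xe]|[e e0 xe]].
  exists e => // y y1 y2; apply: xe; split; rewrite -ball_normE /ball_ /= distrC //.
apply/nbhs_ballP; exists e => //= y [].
by rewrite -ball_normE /ball_ /= => y1 y2; apply: xe; rewrite distrC.
Qed.

Lemma cvg_mean (T : Type) (G : set_system T) {FG : Filter G} (u v : T -> R) (a : R) :
  (\forall z \near G, `|u z - a| <= `|v z - a|) -> v z @[z --> G] --> a ->
  u z @[z --> G] --> a.
Proof.
move=> uv va; apply/cvgrPdist_lt => e e0.
have /cvgrPdist_lt /(_ e e0) ve := va; near=> z.
rewrite distrC; apply: le_lt_trans (near uv z _) _ => //.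
by rewrite distrC; near: z.
Unshelve. all: by end_near. Qed.

(** A chain rule from partial derivatives alone: the increment is split into a horizontal and a
    vertical move, each handled by the mean value theorem, and the continuity of [fx] and [fy] at
    the base point gives the limit of the slope. *)
Lemma is_derive_comp2 (f fx fy : R * R -> R) (c1 c2 : R -> R) (t d1 d2 : R) :
  (\forall x \near (c1 t, c2 t), is_derive (x : R * R) (1, 0) f (fx x) /\
                                 is_derive (x : R * R) (0, 1) f (fy x)) ->
  {for (c1 t, c2 t), continuous fx} -> {for (c1 t, c2 t), continuous fy} ->
  is_derive t 1 c1 d1 -> is_derive t 1 c2 d2 ->
  is_derive t 1 (fun u => f (c1 u, c2 u))
    (fx (c1 t, c2 t) * d1 + fy (c1 t, c2 t) * d2).
Proof.
move=> /near_pairP [e e0 /= fe] cfx cfy dc1 dc2.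
have C1 := is_derive_continuous dc1; have C2 := is_derive_continuous dc2.
move: dc1 dc2 => /is_derive1_caratheodory [k1 [c1E k1t k1d]].
move=> /is_derive1_caratheodory [k2 [c2E k2t k2d]].
set a := (X in is_derive _ _ _ X).
(* [p z] holds the two mean value points; 0 is a default where the curve has left the box. *)
have /choice [p pP] z : exists p : R * R,
    `|c1 z - c1 t| < e -> `|c2 z - c2 t| < e ->
    [/\ `|p.1 - c1 t| <= `|c1 z - c1 t|, `|p.2 - c2 t| <= `|c2 z - c2 t| &
       f (c1 z, c2 z) - f (c1 t, c2 t) =
       (fx (p.1, c2 z) * k1 z + fy (c1 t, p.2) * k2 z) * (z - t)].
  have [c1e|] := ltP `|c1 z - c1 t| e; last by exists 0.
  have [c2e|] := ltP `|c2 z - c2 t| e; last by exists 0.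
  have [|x [x1 xE]] := @mean_value_center (fun u => f (u, c2 z))
      (fun u => fx (u, c2 z)) (c1 t) (c1 z).
    move=> x /le_lt_trans/(_ c1e) xc; apply/is_derive_slicex; apply: (fe (x, c2 z) xc c2e).1.
  have [|y [y1 yE]] := @mean_value_center (fun u => f (c1 t, u))
      (fun u => fy (c1 t, u)) (c2 t) (c2 z).
    move=> y /le_lt_trans/(_ c2e) yc; apply/is_derive_slicey; apply: (fe (c1 t, y) _ yc).2.
    by rewrite subrr normr0.
  exists (x, y) => _ _; split => //=.
  rewrite -(subrKA (f (c1 t, c2 z))) xE yE c1E c2E; ring.
apply/is_derive1_caratheodory.
exists (fun z => if z == t then a else (f (c1 z, c2 z) - f (c1 t, c2 t)) / (z - t)).
split; last by rewrite eqxx.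
  move=> z; case: eqP => [->|/eqP zt]; first by rewrite !subrr mulr0.
  by rewrite divfK // subr_eq0.
rewrite /prop_for /continuous_at /= eqxx.
have near1 : \forall z \near t, `|c1 z - c1 t| < e.
  by have /cvgrPdist_lt /(_ e e0) := C1; apply: filterS => z; rewrite distrC.
have near2 : \forall z \near t, `|c2 z - c2 t| < e.
  by have /cvgrPdist_lt /(_ e e0) := C2; apply: filterS => z; rewrite distrC.
have p1 : (p z).1 @[z --> t] --> c1 t.
  apply: cvg_mean C1; near=> z.
  by have [] := pP z (near near1 z _) (near near2 z _).
have p2 : (p z).2 @[z --> t] --> c2 t.
  apply: cvg_mean C2; near=> z.
  by have [] := pP z (near near1 z _) (near near2 z _).
have : fx ((p z).1, c2 z) * k1 z + fy (c1 t, (p z).2) * k2 z @[z --> t] --> a.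
  rewrite /a -k1d -k2d; apply: cvgD; apply: cvgM => //.
    exact: (cvg_comp _ fx (cvg_pair p1 C2) cfx).
  exact: (cvg_comp _ fy (cvg_pair (cvg_cst (c1 t)) p2) cfy).
apply: cvg_trans; apply: near_eq_cvg; near=> z; case: eqP => [zt|/eqP zt].
  have [//|//|] := pP z (near near1 z _) (near near2 z _).
  rewrite zt !subrr !normr0 !normr_le0 !subr_eq0 => /eqP -> /eqP -> _.
  by rewrite k1d k2d.
have [//|//|_ _ ->] := pP z (near near1 z _) (near near2 z _).
by rewrite mulfK // subr_eq0.
Unshelve. all: by end_near. Qed.

End Calculus.

(** * Functions with derivatives locally bounded up to the closure *)

Section Tame.
Variables (R : realType) (O K : set (R * R)).
Implicit Types (f g : R * R -> R).

(** Of the continuous extension to [K] only this is kept: continuity in [O] feeds the chain rule,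
    boundedness near [K] makes the numerators vanish at the contact points. *)
Definition bounded_near_continuous f : Prop :=
  (forall x, O x -> {for x, continuous f}) /\
  (forall x, K x -> exists C, \forall y \near x, O y -> `|f y| <= C).

Definition has_partials f fx fy : Prop :=
  forall x, O x -> is_derive (x : R * R) (1, 0) f (fx x) /\
                   is_derive (x : R * R) (0, 1) f (fy x).

(** The partial derivatives are quantified rather than computed, so that the class is visibly closed
    under linear combinations, in particular under the components of d/dz and d/dzbar. *)
Fixpoint tame (n : nat) f : Prop :=
  bounded_near_continuous f /\
  if n is m.+1 then
    exists fx fy, [/\ has_partials f fx fy, tame m fx & tame m fy]
  else True.

Lemma tame_bnc n f : tame n f -> bounded_near_continuous f.
Proof. by case: n => [|n] []. Qed.

Lemma has_partials_lin f fx fy g gx gy (a b : R) :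
  has_partials f fx fy -> has_partials g gx gy ->
  has_partials (fun x => a * f x + b * g x) (fun x => a * fx x + b * gx x)
    (fun x => a * fy x + b * gy x).
Proof.
move=> fp gp x Ox; have [fx1 fy1] := fp x Ox; have [gx1 gy1] := gp x Ox.
have -> : (fun x => a * f x + b * g x) = a \*: f + b \*: g by [].
by split; apply: is_deriveD; apply: is_deriveZ.
Qed.

Lemma tame_lin n f g (a b : R) : tame n f -> tame n g ->
  tame n (fun x => a * f x + b * g x).
Proof.
have bnc f' g' : bounded_near_continuous f' -> bounded_near_continuous g' ->
    bounded_near_continuous (fun x => a * f' x + b * g' x).
  move=> [fc fb] [gc gb]; split=> [x Ox|x Kx].
    by apply: cvgD; apply: cvgM; [exact: cvg_cst|exact: fc|exact: cvg_cst|exact: gc].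
  have [C fC] := fb x Kx; have [D gD] := gb x Kx.
  exists (`|a| * C + `|b| * D); near=> y => Oy.
  apply: le_trans (ler_normD _ _) _; rewrite !normrM.
  apply: lerD; apply: ler_wpM2l => //.
    exact: (near fC y).
  exact: (near gD y).
elim: n f g => [|n IH] f g /= [fb F] [gb G]; split; try exact: bnc; first by [].
move: F G => [fx [fy [fp tfx tfy]]] [gx [gy [gp tgx tgy]]].
exists (fun x => a * fx x + b * gx x), (fun x => a * fy x + b * gy x).
by split; [exact: has_partials_lin|exact: IH|exact: IH].
Unshelve. all: by end_near. Qed.

Lemma smooth_upto_tame (F : R * R -> R) : open O -> O `<=` K ->
  smooth_upto O K F -> forall n, tame n F.
Proof.
move=> oO OK [_ sF] n.
(* All iterated derivatives are treated at once, since the partials of [pderivs ds F] are again of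
   this form. *)
suff : forall ds, tame n (pderivs ds F) by move=> /(_ [::]).
have bnc ds : bounded_near_continuous (pderivs ds F).
  have [_ [G [/subspace_continuousP Gc GF]]] := sF ds.
  split=> [x Ox|x Kx].
    rewrite /prop_for /continuous_at -GF //.
    have nO := open_nbhs_nbhs (conj oO Ox).
    have Gx : G @ nbhs x --> G x.
      move=> A GA; have := Gc x (OK x Ox) A GA.
      by apply: filterS2 nO => y Oy; apply; apply: OK.
    apply: cvg_trans Gx; apply: near_eq_cvg.
    by apply: filterS nO => y Oy; rewrite GF.
  have /cvgrPdist_lt /(_ 1 ltr01) H := Gc x Kx.
  exists (`|G x| + 1); move: H; rewrite near_withinE; apply: filterS => y yK Oy.
  rewrite -GF //; move: (yK (OK y Oy)) => /= /ltW.
  move=> GxGy; rewrite -lerBlDl; apply: le_trans GxGy.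
  by apply: le_trans (lerB_dist _ _) _; rewrite distrC.
elim: n => [|n IH] ds; split => //.
exists (pderivs (true :: ds) F), (pderivs (false :: ds) F); split => // x Ox.
by have [/(_ x Ox) D _] := sF ds; split; split=> //; [exact: (D true)|exact: (D false)].
Unshelve. all: by end_near. Qed.

End Tame.

(** * Recovering a polynomial on a disc from its partial derivatives *)

Section Integration.
Variable R : realType.

Definition disc (r : R) (c : R * R) : set (R * R) :=
  [set x | (x.1 - c.1) ^+ 2 + (x.2 - c.2) ^+ 2 < r ^+ 2].

Lemma eq_of_derive (f df g : R -> R) (a b : R) :
  (forall t, `|t - a| <= `|b - a| -> is_derive t 1 f (df t)) ->
  (forall t, `|t - a| <= `|b - a| -> is_derive t 1 g (df t)) ->
  f b = f a + (g b - g a).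
Proof.
move=> fd gd; have [|c [_]] := @mean_value_center R (fun t => f t - g t) (cst 0) a b.
  move=> t ta; apply: is_derive_eq (is_deriveB (fd t ta) (gd t ta)) _.
  by rewrite subrr.
rewrite mul0r => H; apply/subr0_eq; rewrite -H; ring.
Qed.

(** Integration from the centre along the vertical line to [(a, y)], then horizontally to [(x, y)];
    the disc contains both segments. *)
Lemma poly2_of_partials (r : R) (c : R * R) (f fx fy : R * R -> R) n A B :
  has_partials (disc r c) f fx fy -> 0 < r ->
  poly2_lt n A -> poly2_lt n B ->
  (forall x, disc r c x -> fx x = A x.1 x.2) ->
  (forall x, disc r c x -> fy x = B x.1 x.2) ->
  exists P, poly2_lt n.+1 P /\ forall x, disc r c x -> f x = P x.1 x.2.
Proof.
case: c => a b fp r0 An Bn fxA fyB.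
have [A1 [A1n A1d]] := poly2_lt_primitivex An.
have [B1 [B1n B1d]] := poly2_lt_primitivey Bn.
exists (fun x y => (A1 x y - A1 a y) + (B1 a y + (f (a, b) - B1 a b))).
split.
  apply: poly2_ltD; first by apply: poly2_ltD => //; apply/poly2_ltN/poly2_lt_substx.
  by apply: poly2_ltD; [exact: poly2_lt_substx|exact: poly2_lt_cst].
have sq (u v : R) : `|u| <= `|v| -> u ^+ 2 <= v ^+ 2.
  by move=> uv; rewrite -[u ^+ 2]real_normK ?num_real //
    -[v ^+ 2]real_normK ?num_real // lerXn2r ?nnegrE.
move=> [x y] xy.
have fx_eq : f (x, y) = f (a, y) + (A1 x y - A1 a y).
  have dx t : `|t - a| <= `|x - a| -> is_derive t 1 (fun t => f (t, y)) (A t y).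
    move=> /sq ta; have D : disc r (a, b) (t, y).
      by apply: le_lt_trans xy; rewrite /= lerD2r.
    by rewrite -(fxA _ D); apply/is_derive_slicex; exact: (fp _ D).1.
  by have := eq_of_derive dx (fun t _ => A1d t y).
have fy_eq : f (a, y) = f (a, b) + (B1 a y - B1 a b).
  have dy t : `|t - b| <= `|y - b| -> is_derive t 1 (fun t => f (a, t)) (B a t).
    move=> /sq tb; have D : disc r (a, b) (a, t).
      rewrite /disc /= subrr expr0n add0r; apply: le_lt_trans tb _.
      by apply: le_lt_trans xy; rewrite /= lerDr sqr_ge0.
    by rewrite -(fyB _ D); apply/is_derive_slicey; exact: (fp _ D).2.
  by have := eq_of_derive dy (fun t _ => B1d a t).
rewrite fx_eq fy_eq /=; ring.
Qed.

End Integration.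

(** * Complex-valued functions of a real variable *)

Section ComplexDerivative.
Variable R : realType.
Local Notation C := R[i].
Implicit Types (z w : C) (f g : R -> C).

Lemma cReM z w : Re (z * w) = Re z * Re w - Im z * Im w.
Proof. by case: z w => [a b] [c d]. Qed.

Lemma cImM z w : Im (z * w) = Re z * Im w + Im z * Re w.
Proof. by case: z w => [a b] [c d] /=; rewrite addrC [b * c]mulrC. Qed.

Lemma cReD z w : Re (z + w) = Re z + Re w.
Proof. by case: z w => [a b] [c d]. Qed.

Lemma cImD z w : Im (z + w) = Im z + Im w.
Proof. by case: z w => [a b] [c d]. Qed.

Lemma complex_eqP z w : Re z = Re w -> Im z = Im w -> z = w.
Proof. by case: z w => [a b] [c d] /= -> ->. Qed.

Definition is_cderive (t : R) f (l : C) : Prop :=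
  is_derive t 1 (fun u => Re (f u)) (Re l) /\
  is_derive t 1 (fun u => Im (f u)) (Im l).

Lemma cderive_cst (t : R) (k : C) : is_cderive t (fun=> k) 0.
Proof. by split; [exact: (is_derive_cst (Re k) t 1)|exact: (is_derive_cst (Im k) t 1)]. Qed.

Lemma cderiveD (t : R) f g df dg : is_cderive t f df -> is_cderive t g dg ->
  is_cderive t (fun u => f u + g u) (df + dg).
Proof.
move=> [f1 f2] [g1 g2]; split; rewrite ?cReD ?cImD.
  by under eq_fun do rewrite cReD; apply: is_deriveD.
by under eq_fun do rewrite cImD; apply: is_deriveD.
Qed.

Lemma cderiveM (t : R) f g df dg : is_cderive t f df -> is_cderive t g dg ->
  is_cderive t (fun u => f u * g u) (df * g t + f t * dg).
Proof.
move=> [f1 f2] [g1 g2]; split.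
  under eq_fun do rewrite cReM.
  apply: is_derive_eq (is_deriveB (is_deriveM f1 g1) (is_deriveM f2 g2)) _.
  by rewrite /GRing.scale /= cReD !cReM; ring.
under eq_fun do rewrite cImM.
apply: is_derive_eq (is_deriveD (is_deriveM f1 g2) (is_deriveM f2 g1)) _.
by rewrite /GRing.scale /= cImD !cImM; ring.
Qed.

Lemma cderive_eq (t : R) f df dg : is_cderive t f df -> df = dg ->
  is_cderive t f dg.
Proof. by move=> H <-. Qed.

Lemma cderive_horner (p : {poly C}) (t : R) f df : is_cderive t f df ->
  is_cderive t (fun u => p.[f u]) (p^`().[f t] * df).
Proof.
move=> fdf; elim/poly_ind: p => [|p c IH].
  under eq_fun do rewrite horner0.
  by rewrite deriv0 horner0 mul0r; exact: cderive_cst.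
under eq_fun do rewrite hornerMXaddC.
apply: cderive_eq (cderiveD (cderiveM IH fdf) (cderive_cst t c)) _.
by rewrite derivD derivM derivX derivC !hornerE; ring.
Qed.

Lemma cderive_exp (n : nat) (t : R) f df : is_cderive t f df ->
  is_cderive t (fun u => f u ^+ n) (n%:R * f t ^+ n.-1 * df).
Proof.
move=> /(cderive_horner 'X^n); under eq_fun do rewrite hornerXn.
by move=> H; apply: cderive_eq H _; rewrite derivXn hornerMn hornerXn mulr_natl.
Qed.

Lemma cderive_sum (I : Type) (r : seq I) (p : pred I) (f : I -> R -> C)
    (df : I -> C) (t : R) : (forall i, p i -> is_cderive t (f i) (df i)) ->
  is_cderive t (fun u => \sum_(i <- r | p i) f i u) (\sum_(i <- r | p i) df i).
Proof.
move=> fdf; elim: r => [|i r IH].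
  rewrite big_nil; under eq_fun do rewrite big_nil.
  exact: cderive_cst.
rewrite big_cons; under eq_fun do rewrite big_cons.
by case: ifP => // pi; apply: cderiveD; first exact: fdf.
Qed.

Lemma cderive_unique (t : R) f g l k : (\forall u \near t, f u = g u) ->
  is_cderive t f l -> is_cderive t g k -> l = k.
Proof.
move=> fg [f1 f2] [g1 g2]; apply: complex_eqP.
  rewrite -(derive_val (is_derive := f1)) -(derive_val (is_derive := g1)).
  by apply: near_eq_derive; apply: filterS fg => u ->.
rewrite -(derive_val (is_derive := f2)) -(derive_val (is_derive := g2)).
by apply: near_eq_derive; apply: filterS fg => u ->.
Qed.

Definition rot (t : R) : C := (cos t +i* sin t)%C.

Lemma rot0 : rot 0 = 1.
Proof. by rewrite /rot cos0 sin0. Qed.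

(** The derivative at 0 is enough, because a circle is always traversed starting from the point [w]
    under consideration. *)
Lemma cderive_rot (w : C) : is_cderive 0 (fun t => w * rot t) (w * 'i%C).
Proof.
have rot' : is_cderive 0 rot 'i%C.
  split.
    by apply: is_derive_eq (is_derive_cos 0) _; rewrite sin0 oppr0.
  by apply: is_derive_eq (is_derive_sin 0) _; rewrite cos0.
apply: cderive_eq (cderiveM (cderive_cst 0 w) rot') _.
by rewrite mul0r add0r.
Qed.

Definition unitc w : Prop := Re w ^+ 2 + Im w ^+ 2 = 1.

Lemma unitc_rot w t : unitc w -> unitc (w * rot t).
Proof.
rewrite /unitc cReM cImM /= => w1; rewrite -[RHS]mulr1 -{1}w1 -(cos2Dsin2 t).
ring.
Qed.

Lemma unitcM w z : unitc w -> unitc z -> unitc (w * z).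
Proof.
rewrite /unitc cReM cImM => w1 z1; rewrite -[RHS]mulr1 -{1}w1 -z1; ring.
Qed.

Lemma unitc_neq0 w : unitc w -> w != 0.
Proof.
by apply: contra_eqN => /eqP ->; rewrite /= expr0n addr0 eq_sym oner_eq0.
Qed.

Lemma unitc_conj w : unitc w -> w * w^*%C = 1.
Proof.
case: w => [a b]; rewrite /unitc /= => w1.
by apply: complex_eqP; rewrite ?cReM ?cImM /= -?w1; ring.
Qed.

End ComplexDerivative.

(** * Polynomials on the circles of the family *)

Section CircleFamily.
Variables (R : realType) (g1 g2 dg1 dg2 : R -> R) (r : R) (O K : set (R * R)).
Local Notation C := R[i].
Implicit Types (w : C) (s t : R) (f fx fy : R * R -> R).

Definition circle_pt s w : R * R := (g1 s + r * Re w, g2 s + r * Im w).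

Definition tangent s : C := (dg1 s +i* dg2 s)%C.

(** The inner product of the radius with the tangent; for a unit [w] it is zero only at plus or
    minus i times the tangent, where the circle touches the boundary of the annulus. *)
Definition transverse s w : Prop := Re w * dg1 s + Im w * dg2 s != 0.

(* A complex-valued function is stored as the pair of its real and imaginary
   parts. *)
Definition cval (h : (R * R -> R) * (R * R -> R)) (x : R * R) : C :=
  (h.1 x +i* h.2 x)%C.

(* h is the Laurent polynomial w^(l - m) p(w) on each circle; the two natural
   exponents stand in for an integer one. *)
Definition circle_poly (h : (R * R -> R) * (R * R -> R)) (m l M : nat) : Prop :=
  forall s, exists p : {poly C}, (size p <= M)%N /\
    forall w, unitc w -> transverse s w ->
      w ^+ m * cval h (circle_pt s w) = w ^+ l * p.[w].

Hypothesis r_gt0 : 0 < r.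
Hypothesis der_g1 : forall s, is_derive s 1 g1 (dg1 s).
Hypothesis der_g2 : forall s, is_derive s 1 g2 (dg2 s).
Hypothesis cont_dg1 : continuous dg1.
Hypothesis cont_dg2 : continuous dg2.
Hypothesis unit_speed : forall s, unitc (tangent s).
Hypothesis open_O : open O.
Hypothesis transverse_O : forall s w, unitc w -> transverse s w ->
  O (circle_pt s w).
Hypothesis circle_K : forall s w, unitc w -> K (circle_pt s w).

Hypothesis transverse_cover : forall x, O x ->
  exists s w, [/\ unitc w, transverse s w & x = circle_pt s w].

Lemma derive_along_family f fx fy s w : has_partials O f fx fy ->
  {for circle_pt s w, continuous fx} -> {for circle_pt s w, continuous fy} ->
  unitc w -> transverse s w ->
  is_derive s 1 (fun u => f (circle_pt u w))
    (fx (circle_pt s w) * dg1 s + fy (circle_pt s w) * dg2 s).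
Proof.
move=> fp cfx cfy w1 sw.
apply: (@is_derive_comp2 R f fx fy (fun u => g1 u + r * Re w)
  (fun u => g2 u + r * Im w)) => //.
- apply: filterS (open_nbhs_nbhs (conj open_O (transverse_O w1 sw))).
  exact: fp.
- exact: is_derive_addcst.
exact: is_derive_addcst.
Qed.

Lemma derive_along_circle f fx fy s w : has_partials O f fx fy ->
  {for circle_pt s w, continuous fx} -> {for circle_pt s w, continuous fy} ->
  unitc w -> transverse s w ->
  is_derive (0 : R) 1 (fun t => f (circle_pt s (w * rot t)))
    (r * (Re w * fy (circle_pt s w) - Im w * fx (circle_pt s w))).
Proof.
move=> fp cfx cfy w1 sw.
have w0 : w * rot 0 = w by rewrite rot0 mulr1.
have [d1 d2] := cderive_rot w.
have H : is_derive (0 : R) 1 (fun t => f (circle_pt s (w * rot t)))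
   (fx (circle_pt s (w * rot 0)) * (r * Re (w * 'i%C))
   + fy (circle_pt s (w * rot 0)) * (r * Im (w * 'i%C))).
  apply: (@is_derive_comp2 R f fx fy (fun t => g1 s + r * Re (w * rot t))
    (fun t => g2 s + r * Im (w * rot t))) => //.
  - rewrite w0; apply: filterS (open_nbhs_nbhs (conj open_O (transverse_O w1 sw))).
    exact: fp.
  - by rewrite w0.
  - by rewrite w0.
  - exact: is_derive_cstMadd.
  exact: is_derive_cstMadd.
apply: is_derive_eq H _; rewrite w0 cReM cImM /=; ring.
Qed.

(** * Derivatives along the family and along one circle *)

Section Step.
Variables h hx hy : (R * R -> R) * (R * R -> R).
Hypothesis h1_partials : has_partials O h.1 hx.1 hy.1.
Hypothesis h2_partials : has_partials O h.2 hx.2 hy.2.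
Hypothesis hx1_bnc : bounded_near_continuous O K hx.1.
Hypothesis hx2_bnc : bounded_near_continuous O K hx.2.
Hypothesis hy1_bnc : bounded_near_continuous O K hy.1.
Hypothesis hy2_bnc : bounded_near_continuous O K hy.2.

(** The Wirtinger derivative, half of [hx - i hy], in real and imaginary parts. The minus signs sit
    in the coefficients to fit the linear combinations of [tame_lin]. *)
Definition dz : (R * R -> R) * (R * R -> R) :=
  (fun x => 2^-1 * hx.1 x + 2^-1 * hy.2 x,
   fun x => 2^-1 * hx.2 x + (- 2^-1) * hy.1 x).

Definition dzbar : (R * R -> R) * (R * R -> R) :=
  (fun x => 2^-1 * hx.1 x + (- 2^-1) * hy.2 x,
   fun x => 2^-1 * hx.2 x + 2^-1 * hy.1 x).

Lemma cderive_along_family s w : unitc w -> transverse s w ->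
  is_cderive s (fun u => cval h (circle_pt u w))
    (cval dz (circle_pt s w) * tangent s
     + cval dzbar (circle_pt s w) * (tangent s)^*%C).
Proof.
move=> w1 sw; have Ox := transverse_O w1 sw.
split.
  have := derive_along_family h1_partials (hx1_bnc.1 _ Ox) (hy1_bnc.1 _ Ox) w1 sw.
  by move=> H; apply: is_derive_eq H _; rewrite cReD !cReM /=; field.
have := derive_along_family h2_partials (hx2_bnc.1 _ Ox) (hy2_bnc.1 _ Ox) w1 sw.
by move=> H; apply: is_derive_eq H _; rewrite cImD !cImM /=; field.
Qed.

Lemma cderive_along_circle s w : unitc w -> transverse s w ->
  is_cderive 0 (fun t => cval h (circle_pt s (w * rot t)))
    ((0 +i* r)%C * (cval dz (circle_pt s w) * w
     - cval dzbar (circle_pt s w) * w^*%C)).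
Proof.
move=> w1 sw; have Ox := transverse_O w1 sw.
case: w w1 sw Ox => [a b] w1 sw Ox.
split.
  have := derive_along_circle h1_partials (hx1_bnc.1 _ Ox) (hy1_bnc.1 _ Ox) w1 sw.
  by move=> H; apply: is_derive_eq H _; rewrite /= !mulrN; field.
have := derive_along_circle h2_partials (hx2_bnc.1 _ Ox) (hy2_bnc.1 _ Ox) w1 sw.
by move=> H; apply: is_derive_eq H _; rewrite /=; field.
Qed.

Lemma transverse_near s w : transverse s w -> \forall u \near s, transverse u w.
Proof.
move=> sw; have : Re w * dg1 u + Im w * dg2 u @[u --> s] -->
    Re w * dg1 s + Im w * dg2 s.
  by apply: cvgD; apply: cvgM; [exact: cvg_cst|exact: cont_dg1|
    exact: cvg_cst|exact: cont_dg2].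
by move=> H; apply: (cvgr_neq0 _ H sw).
Qed.

Lemma transverse_rot_near s w : transverse s w ->
  \forall t \near 0, transverse s (w * rot t).
Proof.
move=> sw; have [/is_derive_continuous d1 /is_derive_continuous d2] := cderive_rot w.
have : Re (w * rot t) * dg1 s + Im (w * rot t) * dg2 s @[t --> 0] -->
    Re (w * rot 0) * dg1 s + Im (w * rot 0) * dg2 s.
  by apply: cvgD; apply: cvgM; [exact: d1|exact: cvg_cst|
    exact: d2|exact: cvg_cst].
by move=> H; apply: (cvgr_neq0 _ H); rewrite rot0 mulr1.
Qed.


(** Unit vectors with tangential component [j.+1%:R^-1]: nonzero, hence transverse at [s], and
    different for different [j], so that any number of interpolation nodes is available. *)
Definition node s (j : nat) : C :=
  tangent s * (j.+1%:R^-1 +i* Num.sqrt (1 - j.+1%:R^-1 ^+ 2))%C.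

Lemma node_unit s j : unitc (node s j).
Proof.
apply: unitcM => //; rewrite /unitc /= sqr_sqrtr; first by rewrite addrC subrK.
by rewrite subr_ge0 expr_le1 ?invr_ge0 // invf_le1 ?ltr0n // ler1n.
Qed.

Lemma node_inj s : injective (node s).
Proof.
move=> j k /(mulfI (unitc_neq0 (unit_speed s))) [] /invr_inj /eqP.
by rewrite eqr_nat => /eqP [].
Qed.

Lemma node_transverse s j : transverse s (node s j).
Proof.
rewrite /transverse cReM cImM /=; set a := _^-1; set b := Num.sqrt _.
have -> : (dg1 s * a - dg2 s * b) * dg1 s + (dg1 s * b + dg2 s * a) * dg2 s =
  a * (dg1 s ^+ 2 + dg2 s ^+ 2) by ring.
by rewrite (unit_speed s) mulr1 invr_eq0 pnatr_eq0.
Qed.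

(* Near s the polynomial on the circle is recovered from its values at fixed
   nodes, so its variation with s is again polynomial of the same degree. *)
Lemma circle_poly_along_family m l M s : (0 < M)%N -> circle_poly h m l M ->
  exists q : {poly C}, (size q <= M)%N /\ forall w, unitc w -> transverse s w ->
    w ^+ m * (cval dz (circle_pt s w) * tangent s
              + cval dzbar (circle_pt s w) * (tangent s)^*%C) = w ^+ l * q.[w].
Proof.
move=> M0 hp; pose x := node s; have x_inj : injective x := @node_inj s.
pose V (w : C) := cval dz (circle_pt s w) * tangent s
              + cval dzbar (circle_pt s w) * (tangent s)^*%C.
pose L (j : 'I_M) : {poly C} := tnth (M.-lagrange x) j.
have x0 j : x j != 0 by apply/unitc_neq0/node_unit.
(* Lagrange interpolation of the values forced on [q] at the nodes, obtained by solving the required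
   identity for [q] at [w = x j]. *)
exists (\sum_(j < M) (x j ^- l * (x j ^+ m * V (x j))) *: L j); split.
  rewrite (leq_trans (size_sum _ _ _)) //; apply/bigmax_leqP => j _.
  by rewrite (leq_trans (size_scale_leq _ _)) ?size_npoly.
move=> w w1 sw; rewrite -/(V w).
have HV w' : unitc w' -> transverse s w' ->
    is_cderive s (fun u => cval h (circle_pt u w')) (V w').
  exact: cderive_along_family.
have lhs := cderiveM (cderive_cst s (w ^+ m)) (HV w w1 sw).
have rhs : is_cderive s
   (fun u => \sum_(j < M) (w ^+ l * x j ^- l * x j ^+ m * (L j).[w]) *
     cval h (circle_pt u (x j)))
   (\sum_(j < M) (0 * cval h (circle_pt s (x j)) +
     (w ^+ l * x j ^- l * x j ^+ m * (L j).[w]) * V (x j))).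
  apply: cderive_sum => j _; apply: cderiveM; first exact: cderive_cst.
  by apply: HV; [exact: node_unit|exact: node_transverse].
have E := cderive_unique _ lhs rhs.
rewrite mul0r add0r in E; rewrite E.
  rewrite horner_sum mulr_sumr; apply: eq_bigr => j _.
  by rewrite hornerZ mul0r add0r; ring.
(* The nodes belong to [s] and stay fixed while [u] varies; being finitely many, they remain
   transverse on a common neighbourhood. *)
have nodes_near : \forall u \near s, forall j : 'I_M, transverse u (x j).
  apply: (@filter_forall R _ (fun (j : 'I_M) u => transverse u (x j)) (nbhs s)
    (nbhs_filter s)) => j.
  exact/transverse_near/node_transverse.
apply: filterS2 (transverse_near sw) nodes_near => u uw ux.
have [p [pM pE]] := hp u.
rewrite pE // [p](lagrange_gen M0 x_inj pM) horner_sum mulr_sumr.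
apply: eq_bigr => j _; rewrite hornerM hornerC.
have -> : p.[x j] = x j ^- l * (x j ^+ m * cval h (circle_pt u (x j))).
  by rewrite pE //; [rewrite mulKf // expf_neq0|exact: node_unit].
by rewrite -/(L j); ring.
Qed.

(** The angular derivative acts as i w d/dw: it multiplies each coefficient of the Laurent
    polynomial by i times its exponent and so keeps the range of exponents. *)
Lemma circle_poly_along_circle (m l : nat) (p : {poly C}) s :
  (forall w, unitc w -> transverse s w ->
      w ^+ m * cval h (circle_pt s w) = w ^+ l * p.[w]) ->
  forall w, unitc w -> transverse s w ->
    w ^+ m * ((0 +i* r)%C * (cval dz (circle_pt s w) * w
     - cval dzbar (circle_pt s w) * w^*%C)) =
    w ^+ l * ('i%C * ((l%:R - m%:R) * p.[w] + w * p^`().[w])).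
Proof.
move=> pE w w1 sw.
have w0 := unitc_neq0 w1.
have dw := cderive_rot w.
have lhs := cderiveM (cderive_exp m dw) (cderive_along_circle w1 sw).
have rhs := cderiveM (cderive_exp l dw) (cderive_horner p dw).
have := cderive_unique _ lhs rhs; rewrite rot0 !mulr1 => E.
have eqn : \forall u \near (0 : R),
    (w * rot u) ^+ m * cval h (circle_pt s (w * rot u)) =
    (w * rot u) ^+ l * p.[w * rot u].
  by apply: filterS (transverse_rot_near sw) => t wt; apply: pE => //; exact: unitc_rot.
move: {E} (E eqn).
(* At [k = 0] the predecessor is truncated, but the factor [k%:R] kills the term. *)
have X k : k%:R * w ^+ k.-1 * (w * 'i%C) = k%:R * w ^+ k * 'i%C.
  by case: k => [|k]; rewrite ?mul0r //= exprS; ring.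
rewrite !X => /(canRL (addKr _)) ->.
have -> : m%:R * w ^+ m * 'i%C * cval h (circle_pt s w) =
   m%:R * 'i%C * (w ^+ m * cval h (circle_pt s w)) by ring.
rewrite pE //; ring.
Qed.

End Step.

(** Since conj(w) = 1/w, the divisor is w times the sum of e conj(w) and its conjugate, which is
    real. Its zeros on the unit circle are therefore exactly the non-transverse points. *)
Lemma transverse_factor s w : unitc w ->
  tangent s + (tangent s)^*%C * w ^+ 2 =
  w * (2 * (Re w * dg1 s + Im w * dg2 s))%:C%C.
Proof.
case: w => [a b]; rewrite /unitc /= => w1.
apply: complex_eqP; rewrite expr2 ?(cReD, cImD, cReM, cImM) /=; last first.
  apply/subr0_eq; transitivity (dg2 s * (1 - (a ^+ 2 + b ^+ 2))); first by ring.
  by rewrite w1 subrr mulr0.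
apply/subr0_eq; transitivity (dg1 s * (1 - (a ^+ 2 + b ^+ 2))); first by ring.
by rewrite w1 subrr mulr0.
Qed.

(* The left-hand side is bounded times a factor vanishing at the point w0 where
   the circle touches the boundary of the annulus. *)
Lemma circle_poly_vanish k (n : {poly C}) (m l : nat) s w0 :
  bounded_near_continuous O K k.1 -> bounded_near_continuous O K k.2 ->
  (forall w, unitc w -> transverse s w ->
    w ^+ m * cval k (circle_pt s w) * (tangent s + (tangent s)^*%C * w ^+ 2)
    = w ^+ l * n.[w]) ->
  unitc w0 -> Re w0 * dg1 s + Im w0 * dg2 s = 0 -> n.[w0] = 0.
Proof.
move=> [_ k1b] [_ k2b] nE w01 A0.
pose w t := w0 * rot t.
have w_unit t : unitc (w t) by exact: unitc_rot.
(* As [w0] is orthogonal to the unit tangent, the inner product along the arc is plus or minus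
   [sin t]. *)
have w_trans t : 0 < t < pi -> transverse s (w t).
  move=> /sin_gt0_pi st; rewrite /transverse /w cReM cImM /=.
  rewrite (_ : _ + _ = (Re w0 * dg1 s + Im w0 * dg2 s) * cos t +
    (Re w0 * dg2 s - Im w0 * dg1 s) * sin t); last by ring.
  rewrite A0 mul0r add0r mulf_neq0 //; last by rewrite gt_eqF.
  have : (Re w0 * dg1 s + Im w0 * dg2 s) ^+ 2 +
         (Re w0 * dg2 s - Im w0 * dg1 s) ^+ 2 = 1.
    rewrite -[RHS]mulr1 -{1}w01 -(unit_speed s) /=; ring.
  rewrite A0 expr0n /= add0r; apply: contra_eqN => /eqP ->.
  by rewrite expr0n /= eq_sym oner_eq0.
pose D t := w t ^+ m * (tangent s + (tangent s)^*%C * w t ^+ 2).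
pose F t := w t ^+ l * n.[w t].
have dw := cderive_rot w0.
have [F1 F2] := cderiveM (cderive_exp l dw) (cderive_horner n dw).
have [D1 D2] := cderiveM (cderive_exp m dw) (cderiveD (cderive_cst 0 (tangent s))
  (cderiveM (cderive_cst 0 (tangent s)^*%C) (cderive_exp 2 dw))).
move/is_derive_continuous/cvg_at_right_filter: F1 => F1.
move/is_derive_continuous/cvg_at_right_filter: F2 => F2.
move/is_derive_continuous/cvg_at_right_filter: D1 => D1.
move/is_derive_continuous/cvg_at_right_filter: D2 => D2.
have wz : w0 * rot 0 = w0 by rewrite rot0 mulr1.
have Dz : w0 ^+ m * (tangent s + (tangent s)^*%C * w0 ^+ 2) = 0.
  by rewrite transverse_factor // A0 mulr0 !mulr0.
rewrite !wz in F1 F2; rewrite !wz Dz in D1 D2.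
have ptc : circle_pt s (w t) @[t --> 0] --> circle_pt s w0.
  have [/is_derive_continuous c1 /is_derive_continuous c2] := dw.
  have p1 : g1 s + r * Re (w t) @[t --> 0] --> g1 s + r * Re (w0 * rot 0).
    by apply: cvgD; [exact: cvg_cst|apply: cvgM c1; exact: cvg_cst].
  have p2 : g2 s + r * Im (w t) @[t --> 0] --> g2 s + r * Im (w0 * rot 0).
    by apply: cvgD; [exact: cvg_cst|apply: cvgM c2; exact: cvg_cst].
  by rewrite wz in p1 p2; exact: cvg_pair p1 p2.
have [C1 k1C] := k1b _ (circle_K s w01).
have [C2 k2C] := k2b _ (circle_K s w01).
have near_w (P : set (R * R)) : (\forall x \near circle_pt s w0, P x) ->
    \forall t \near 0^'+, P (circle_pt s (w t)).
  by move=> /ptc; apply: cvg_at_right_filter.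
have bnd : \forall t \near 0^'+,
    `|Re (F t)| <= C1 * `|Re (D t)| + C2 * `|Im (D t)| /\
    `|Im (F t)| <= C2 * `|Re (D t)| + C1 * `|Im (D t)|.
  near=> t.
  have wt : transverse s (w t).
    by apply: w_trans; apply/andP; split; near: t; [exact: nbhs_right_gt|
      apply: nbhs_right_lt; exact: pi_gt0].
  have Ot := transverse_O (w_unit t) wt.
  have b1 := near (near_w _ k1C) t _ Ot; have b2 := near (near_w _ k2C) t _ Ot.
  have -> : F t = D t * cval k (circle_pt s (w t)).
    by rewrite /F -nE // /D; ring.
  rewrite cReM cImM /=; split.
    apply: le_trans (ler_normB _ _) _; rewrite !normrM [C1 * _]mulrC [C2 * _]mulrC.
    by apply: lerD; apply: ler_wpM2l => //; [exact: b1|exact: b2].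
  apply: le_trans (ler_normD _ _) _; rewrite !normrM [C1 * _]mulrC [C2 * _]mulrC.
  by apply: lerD; apply: ler_wpM2l => //; [exact: b2|exact: b1].
have D0 (c c' : R) : c * `|Re (D t)| + c' * `|Im (D t)| @[t --> 0^'+] --> (0 : R).
  have /= : c * `|Re (D t)| + c' * `|Im (D t)| @[t --> 0^'+] -->
      c * `|Re (0 : C)| + c' * `|Im (0 : C)|.
    apply: cvgD; apply: cvgM; [exact: cvg_cst|exact: cvg_norm D1|exact: cvg_cst|
      exact: cvg_norm D2].
  by rewrite normr0 !mulr0 addr0.
have lim0 (u v : R -> R) a : (\forall t \near 0^'+, `|u t| <= v t) ->
    v t @[t --> 0^'+] --> (0 : R) -> u t @[t --> 0^'+] --> a -> a = 0.
  move=> uv v0 ua; apply: (cvg_unique (@norm_hausdorff R R) ua).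
  apply/norm_cvg0P.
  apply: (squeeze_cvgr _ (cvg_cst 0) v0).
  by apply: filterS uv => t ->; rewrite normr_ge0.
have : w0 ^+ l * n.[w0] = 0.
  apply: complex_eqP.
    by apply: lim0 (D0 C1 C2) F1; apply: filterS bnd => t [].
  by apply: lim0 (D0 C2 C1) F2; apply: filterS bnd => t [].
by move/eqP; rewrite mulf_eq0 (negPf (expf_neq0 _ (unitc_neq0 w01))) => /eqP.
Unshelve. all: by end_near. Qed.

(** As e conj(e) = 1, the divisor equals conj(e) (w - ie) (w + ie). The numerator vanishes at both
    distinct roots, so the quotient is a polynomial with two coefficients fewer. *)
Lemma circle_poly_divide k (n : {poly C}) (m l M : nat) s :
  bounded_near_continuous O K k.1 -> bounded_near_continuous O K k.2 ->
  (size n <= M.+2)%N ->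
  (forall w, unitc w -> transverse s w ->
    w ^+ m * cval k (circle_pt s w) * (tangent s + (tangent s)^*%C * w ^+ 2)
    = w ^+ l * n.[w]) ->
  exists q : {poly C}, (size q <= M)%N /\ forall w, unitc w -> transverse s w ->
    w ^+ m * cval k (circle_pt s w) = w ^+ l * q.[w].
Proof.
move=> k1b k2b nM nE; set e := tangent s in nE *.
have e1 : unitc e := unit_speed s; have eJ := unitc_conj e1.
pose z : C := 'i%C * e.
have i2 : 'i%C * 'i%C = -1 :> C by rewrite -expr2 sqr_i.
have nz : n.[z] = 0.
  apply: (circle_poly_vanish k1b k2b nE); last by rewrite cReM cImM /=; ring.
  by apply: unitcM => //; rewrite /unitc /= expr0n expr1n add0r.
have nNz : n.[- z] = 0.
  apply: (circle_poly_vanish k1b k2b nE); last first.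
    by rewrite -mulN1r !cReM !cImM /=; ring.
  rewrite -mulN1r; apply: unitcM;
    first by rewrite /unitc /= oppr0 expr0n sqrrN expr1n addr0.
  by apply: unitcM => //; rewrite /unitc /= expr0n expr1n add0r.
have z0 : z != 0 by rewrite mulf_neq0 ?unitc_neq0 // /unitc /= expr0n expr1n add0r.
have /factor_theorem [p pE] : root n z by apply/eqP.
have /factor_theorem [q qE] : root p (- z).
  move/eqP: nNz; rewrite pE hornerM hornerXsubC mulf_eq0 => /orP[] //.
  by rewrite -opprD oppr_eq0 -mulr2n mulrn_eq0 (negPf z0).
(* The factor [e] is the inverse of the leading coefficient conj(e) of the divisor. *)
exists (e *: q); split.
  have [->|q0] := eqVneq q 0; first by rewrite scaler0 size_poly0.
  rewrite (leq_trans (size_scale_leq _ _)) // -2!ltnS; move: nM.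
  rewrite pE qE size_Mmonic ?monicXsubC ?mulf_neq0 ?polyXsubC_eq0 //.
  by rewrite size_Mmonic ?monicXsubC // !size_XsubC !addn2.
move=> w w1 sw; have := nE w w1 sw.
have D0 : e + e^*%C * w ^+ 2 != 0.
  rewrite transverse_factor //; apply: mulf_neq0; first exact: unitc_neq0.
  by rewrite eq_complex /= negb_and mulf_neq0.
move=> H; apply: (mulIf D0); rewrite H pE qE !hornerM !hornerXsubC hornerZ.
have -> : e + e^*%C * w ^+ 2 = e^*%C * (w ^+ 2 + e ^+ 2).
  by rewrite -{1}[e]mul1r -eJ; ring.
have -> : q.[w] * (w - - z) * (w - z) = q.[w] * (w ^+ 2 + e ^+ 2).
  by rewrite /z; transitivity (q.[w] * (w ^+ 2 - ('i%C * 'i%C) * e ^+ 2));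
    [ring | rewrite i2; ring].
transitivity (w ^+ l * (e * e^*%C) * q.[w] * (w ^+ 2 + e ^+ 2)); last by ring.
by rewrite eJ; ring.
Qed.

Lemma size_mulX (p : {poly C}) M : (size p <= M)%N -> (size ('X * p)%R <= M.+1)%N.
Proof.
by move=> pM; rewrite (leq_trans (size_polyMleq _ _)) // size_polyX.
Qed.

Lemma size_Xderiv (p : {poly C}) (c : C) M : (size p <= M.+1)%N ->
  (size (c *: p + 'X * p^`())%R <= M.+1)%N.
Proof.
move=> pM; rewrite (leq_trans (size_polyD _ _)) // geq_max.
rewrite (leq_trans (size_scale_leq _ _)) // size_mulX //.
have [->|p0] := eqVneq p 0; first by rewrite deriv0 size_poly0.
by rewrite -ltnS (leq_trans (lt_size_deriv p0)).
Qed.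

Lemma imag_r_neq0 : (0 +i* r)%C != 0 :> C.
Proof. by rewrite eq_complex /= eqxx gt_eqF. Qed.

(** * Loss of one exponent under each Wirtinger derivative *)

Section Descent.
Variables h hx hy : (R * R -> R) * (R * R -> R).
Hypothesis h1_partials : has_partials O h.1 hx.1 hy.1.
Hypothesis h2_partials : has_partials O h.2 hx.2 hy.2.
Variable j : nat.
Hypothesis hx1_tame : tame O K j hx.1.
Hypothesis hx2_tame : tame O K j hx.2.
Hypothesis hy1_tame : tame O K j hy.1.
Hypothesis hy2_tame : tame O K j hy.2.

Lemma dz_tame : tame O K j (dz hx hy).1 /\ tame O K j (dz hx hy).2.
Proof. by split; apply: tame_lin. Qed.

Lemma dzbar_tame : tame O K j (dzbar hx hy).1 /\ tame O K j (dzbar hx hy).2.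
Proof. by split; apply: tame_lin. Qed.

Let hx1_bnc := tame_bnc hx1_tame.
Let hx2_bnc := tame_bnc hx2_tame.
Let hy1_bnc := tame_bnc hy1_tame.
Let hy2_bnc := tame_bnc hy2_tame.

(** Adding conj(e) w / (ir) times the identity along the circle to the one along the family cancels
    [dzbar], because w conj(w) = 1. The factor w raises the size to [M.+2], and the division brings
    it down to [M]. *)
Lemma circle_poly_dz m l M :
  circle_poly h m l M.+1 -> circle_poly (dz hx hy) m l M.
Proof.
move=> hp s; have [p [pM pE]] := hp s.
have [q [qM qE]] := circle_poly_along_family h1_partials h2_partials
  hx1_bnc hx2_bnc hy1_bnc hy2_bnc s (ltn0Sn M) hp.
have tE := circle_poly_along_circle h1_partials h2_partials
  hx1_bnc hx2_bnc hy1_bnc hy2_bnc pE.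
pose n := q + ((tangent s)^*%C / (0 +i* r)%C) *:
  ('X * ('i%C *: ((l%:R - m%:R) *: p + 'X * p^`()))).
have [T1 T2] := dz_tame.
apply: (@circle_poly_divide _ n _ _ _ _ (tame_bnc T1) (tame_bnc T2)).
  rewrite (leq_trans (size_polyD _ _)) // geq_max (leq_trans qM) //=.
  rewrite (leq_trans (size_scale_leq _ _)) // size_mulX //.
  by rewrite (leq_trans (size_scale_leq _ _)) // size_Xderiv.
move=> w w1 sw; rewrite /n hornerD hornerZ hornerM hornerX hornerZ hornerD
  hornerZ hornerM hornerX [w ^+ l * _]mulrDr -qE //.
set T := 'i%C * _; set c := (tangent s)^*%C.
have -> : w ^+ l * (c / (0 +i* r)%C * (w * T)) = c / (0 +i* r)%C * w * (w ^+ l * T).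
  by ring.
rewrite -tE // -/c; set a := cval (dz hx hy) _; set b := cval (dzbar hx hy) _.
have wJ := unitc_conj w1.
transitivity (w ^+ m * (a * tangent s + b * c * (1 - w * w^*%C) + c * a * w ^+ 2)).
  by rewrite wJ; ring.
by field; exact: imag_r_neq0.
Qed.

(** Now [dz] is cancelled: w^2 times the family identity minus e w / (ir) times the circle identity.
    Both right-hand sides share a factor w, which passes into [l.+1]: this is the lost bottom
    exponent. *)
Lemma circle_poly_dzbar m l M :
  circle_poly h m l M.+1 -> circle_poly (dzbar hx hy) m l.+1 M.
Proof.
move=> hp s; have [p [pM pE]] := hp s.
have [q [qM qE]] := circle_poly_along_family h1_partials h2_partials
  hx1_bnc hx2_bnc hy1_bnc hy2_bnc s (ltn0Sn M) hp.
have tE := circle_poly_along_circle h1_partials h2_partials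
  hx1_bnc hx2_bnc hy1_bnc hy2_bnc pE.
pose n := 'X * q + (- (tangent s / (0 +i* r)%C)) *:
  ('i%C *: ((l%:R - m%:R) *: p + 'X * p^`())).
have [T1 T2] := dzbar_tame.
apply: (@circle_poly_divide _ n _ _ _ _ (tame_bnc T1) (tame_bnc T2)).
  rewrite (leq_trans (size_polyD _ _)) // geq_max size_mulX //=.
  rewrite (leq_trans (size_scale_leq _ _)) //.
  by rewrite (leq_trans (size_scale_leq _ _)) // ltnW // ltnS size_Xderiv.
move=> w w1 sw; rewrite /n hornerD hornerZ hornerM hornerX hornerZ hornerD
  hornerZ hornerM hornerX.
set T := 'i%C * _; set e := tangent s.
have -> : w ^+ l.+1 * (w * q.[w] + - (e / (0 +i* r)%C) * T) =
  w ^+ 2 * (w ^+ l * q.[w]) - e / (0 +i* r)%C * w * (w ^+ l * T).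
  by rewrite exprS; ring.
rewrite -tE // -qE // -/e; set a := cval (dz hx hy) _; set b := cval (dzbar hx hy) _.
have wJ := unitc_conj w1.
transitivity (w ^+ m * (b * e^*%C * w ^+ 2 + b * e * (w * w^*%C))).
  by rewrite wJ; ring.
by field; exact: imag_r_neq0.
Qed.

End Descent.

Lemma circle_poly0 h m l : circle_poly h m l 0 ->
  forall s w, unitc w -> transverse s w -> cval h (circle_pt s w) = 0.
Proof.
move=> hp s w w1 sw; have [p []] := hp s.
rewrite leqn0 size_poly_eq0 => /eqP -> /(_ w w1 sw) /eqP.
by rewrite horner0 mulr0 mulf_eq0 (negPf (expf_neq0 _ (unitc_neq0 w1))) => /eqP.
Qed.

(** Induction on the number of exponents, with [m], [l] and [h] varying since it is applied to both
    Wirtinger derivatives. With no exponent left [h] vanishes on [O], which transverse points cover;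
    each level of integration adds one degree. *)
Lemma circle_poly_local M h m l c :
  tame O K M h.1 -> tame O K M h.2 -> circle_poly h m l M -> disc r c `<=` O ->
  exists P1 P2, [/\ poly2_lt M P1, poly2_lt M P2 & forall x, disc r c x ->
    h.1 x = P1 x.1 x.2 /\ h.2 x = P2 x.1 x.2].
Proof.
move=> + + + cO; elim: M => [|M IH] in m l h *.
  move=> _ _ hp; exists (fun _ _ => 0), (fun _ _ => 0).
  split; [exact: poly2_lt_0|exact: poly2_lt_0|move=> x /cO Ox].
  have [s [w [w1 sw ->]]] := transverse_cover Ox.
  by have [-> ->] := circle_poly0 hp w1 sw.
move=> [_ [fx1 [fy1 [p1 tx1 ty1]]]] [_ [fx2 [fy2 [p2 tx2 ty2]]]] hp.
pose hx := (fx1, fx2); pose hy := (fy1, fy2).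
have [z1 z2] := @dz_tame hx hy M tx1 tx2 ty1 ty2.
have [zb1 zb2] := @dzbar_tame hx hy M tx1 tx2 ty1 ty2.
have [A1 [A2 [A1M A2M AE]]] := IH _ _ _ z1 z2
  (@circle_poly_dz h hx hy p1 p2 M tx1 tx2 ty1 ty2 _ _ _ hp).
have [B1 [B2 [B1M B2M BE]]] := IH _ _ _ zb1 zb2
  (@circle_poly_dzbar h hx hy p1 p2 M tx1 tx2 ty1 ty2 _ _ _ hp).
(* Back to real partials by [hx = dz + dzbar] and [hy = i (dz - dzbar)], separated into
   components. *)
have [|x cx|x cx|P1 [P1M P1E]] := @poly2_of_partials R r c h.1 fx1 fy1 M
    (fun x y => A1 x y + B1 x y) (fun x y => B2 x y - A2 x y) _ r_gt0
    (poly2_ltD A1M B1M) (poly2_ltD B2M (poly2_ltN A2M)).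
- by move=> x /cO; exact: p1.
- by rewrite -(AE x cx).1 -(BE x cx).1 /=; field.
- by rewrite -(AE x cx).2 -(BE x cx).2 /=; field.
have [|x cx|x cx|P2 [P2M P2E]] := @poly2_of_partials R r c h.2 fx2 fy2 M
    (fun x y => A2 x y + B2 x y) (fun x y => A1 x y - B1 x y) _ r_gt0
    (poly2_ltD A2M B2M) (poly2_ltD A1M (poly2_ltN B1M)).
- by move=> x /cO; exact: p2.
- by rewrite -(AE x cx).2 -(BE x cx).2 /=; field.
- by rewrite -(AE x cx).1 -(BE x cx).1 /=; field.
by exists P1, P2; split => // x cx; split; [exact: P1E|exact: P2E].
Qed.

(* On |w| = 1 the coordinates of the point are A(w) / w and B(w) / w with A and
   B quadratic, so multiplying by w^N clears the denominators. *)
Lemma circle_poly_of_poly2 N (F : R * R -> R) :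
  (forall s, exists P, poly2_le N P /\
     forall w, unitc w -> F (circle_pt s w) = P (circle_pt s w).1 (circle_pt s w).2) ->
  circle_poly (F, fun=> 0) N 0 (2 * N).+1.
Proof.
move=> FP s; have [P [[c Pc] FE]] := FP s.
(* On the unit circle w Re w = (w^2 + 1) / 2 and w Im w = -i (w^2 - 1) / 2. *)
pose A : {poly C} := (g1 s)%:C%C *: 'X + (r / 2)%:C%C *: ('X^2 + 1).
pose B : {poly C} := (g2 s)%:C%C *: 'X + (0 +i* (- (r / 2)))%C *: ('X^2 - 1).
have q3 (a b e : C) : (size (a *: 'X + b *: ('X^2 + e%:P))%R <= 3)%N.
  rewrite (leq_trans (size_polyD _ _)) // geq_max.
  rewrite (leq_trans (size_scale_leq _ _)) ?size_polyX //=.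
  rewrite (leq_trans (size_scale_leq _ _)) //.
  by rewrite size_polyDl ?size_polyXn // (leq_ltn_trans (size_polyC_leq1 _)).
have A3 : (size A <= 3)%N by have := q3 (g1 s)%:C%C (r / 2)%:C%C 1; rewrite polyC1.
have B3 : (size B <= 3)%N.
  by have := q3 (g2 s)%:C%C (0 +i* (- (r / 2)))%C (-1); rewrite polyCN polyC1.
(* A monomial uses up [i + j] of the [N] factors w; the power of ['X] accounts for the others. *)
exists (\sum_(i < N.+1) \sum_(j < N.+1 | (i + j <= N)%N)
   (c i j)%:C%C *: (A ^+ i * B ^+ j * 'X^(N - (i + j)))); split.
  rewrite (leq_trans (size_sum _ _ _)) //; apply/bigmax_leqP => i _.
  rewrite (leq_trans (size_sum _ _ _)) //; apply/bigmax_leqP => j ij.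
  rewrite (leq_trans (size_scale_leq _ _)) //.
  have Ai : (size (A ^+ i)%R <= (2 * i).+1)%N.
    by rewrite (leq_trans (size_poly_exp_leq _ _)) // ltnS leq_mul2r -ltnS; lia.
  have Bj : (size (B ^+ j)%R <= (2 * j).+1)%N.
    by rewrite (leq_trans (size_poly_exp_leq _ _)) // ltnS leq_mul2r -ltnS; lia.
  have AB := size_polyMleq (A ^+ i) (B ^+ j).
  have := size_polyMleq (A ^+ i * B ^+ j) 'X^(N - (i + j)).
  rewrite size_polyXn; lia.
move=> w w1 _; rewrite expr0 mul1r /cval /= FE //.
have wJ := unitc_conj w1.
have Aw : A.[w] = w * (g1 s + r * Re w)%:C%C.
  rewrite /A !(hornerD, hornerZ, hornerX, hornerXn, hornerC) -wJ expr2 -mulrDr.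
  rewrite addcJ; transitivity (w * ((g1 s)%:C + (r / 2 * (2 * Re w))%:C)%C).
    by rewrite !rmorphM /= rmorph_nat; ring.
  by rewrite -rmorphD /=; congr (_ * (_ + _)%:C%C); field.
have Bw : B.[w] = w * (g2 s + r * Im w)%:C%C.
  rewrite /B !(hornerD, hornerZ, hornerX, hornerXn, hornerN, hornerC) -wJ expr2 -mulrBr.
  rewrite subcJ; transitivity (w * ((g2 s)%:C%C +
      (0 +i* - (r / 2))%C * 'i%C * (2 * (Im w)%:C%C))); first by ring.
  by congr (_ * _); apply: complex_eqP; rewrite ?(cReD, cImD, cReM, cImM) /=; field.
rewrite Pc (_ : (_ +i* 0)%C = (\sum_(i < N.+1) \sum_(j < N.+1 | (i + j <= N)%N)
     c i j * (circle_pt s w).1 ^+ i * (circle_pt s w).2 ^+ j)%:C%C) //.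
rewrite rmorph_sum mulr_sumr horner_sum; apply: eq_bigr => i _.
rewrite rmorph_sum mulr_sumr horner_sum; apply: eq_bigr => j ij.
rewrite hornerZ !hornerM !horner_exp hornerX Aw Bw !rmorphM !rmorphXn /=.
have {1}-> : N = (i + j + (N - (i + j)))%N by rewrite subnKC.
by rewrite !exprD !exprMn; ring.
Qed.

End CircleFamily.

(** * Geometry of the annulus *)

Section Geometry.
Variable R : realType.

Lemma periodic_reduce (f : R -> R) (L u : R) : 0 < L -> periodic f L ->
  exists2 v, 0 <= v < L & f v = f u.
Proof.
move=> L0 fL; have fLz (k : int) a : f (a - k%:~R * L) = f a.
  case: k => n; first by rewrite -(periodicn fL n) -pmulrn mulr_natl subrK.
  by rewrite NegzE mulrNz mulNr opprK -pmulrn mulr_natl (periodicn fL n.+1).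
exists (u - (Num.floor (u / L))%:~R * L); last exact: fLz.
have /andP[] := floor_itv (u / L); rewrite intrD -(ler_pM2r L0) -(ltr_pM2r L0).
rewrite divfK ?gt_eqF // mulrDl mul1r => H1 H2.
by rewrite subr_ge0 H1 ltrBlDl.
Qed.

Lemma periodic_max (f df : R -> R) (L : R) : 0 < L -> periodic f L ->
  (forall s : R, is_derive s 1 f (df s)) ->
  exists s, [/\ 0 <= s < L, forall u, f u <= f s & df s = 0].
Proof.
move=> L0 fL fd.
have [|c cI cmax] := @EVT_max R f 0 L (ltW L0).
  by apply: derivable_within_continuous => x _; case: (fd x).
have fmax u : f u <= f c.
  have [v /andP[v0 vL] <-] := periodic_reduce u L0 fL.
  by apply: cmax; rewrite in_itv /= v0 ltW.
have [s sI sc] := periodic_reduce c L0 fL.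
exists s; split => [//|u|]; first by rewrite sc.
(* By periodicity [s] is a maximum on the whole line, hence interior to this interval even if it is
   an endpoint of the period. *)
have := @derive1_at_max R f (s - 1) (s + 1) s.
have -> : s - 1 <= s + 1 by rewrite lerD2l; lra.
have -> : s \in `]s - 1, s + 1[ by rewrite in_itv /=; apply/andP; split; lra.
move=> /(_ isT) H.
have [||_ <-] := H _ isT; [by move=> t _; case: (fd t)|by move=> t _; rewrite sc|].
by case: (fd s).
Qed.

Lemma periodic_min (f df : R -> R) (L : R) : 0 < L -> periodic f L ->
  (forall s : R, is_derive s 1 f (df s)) ->
  exists s, [/\ 0 <= s < L, forall u, f s <= f u & df s = 0].
Proof.
move=> L0 fL fd.
have NfL : periodic (fun x => - f x) L by move=> u; rewrite fL.
have Nfd (s : R) : is_derive s 1 (fun x => - f x) (- df s) by apply: is_deriveN.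
have [s [sI smax ds]] := periodic_max L0 NfL Nfd.
exists s; split => // [u|]; first by rewrite -lerN2.
by apply/eqP; rewrite -oppr_eq0; apply/eqP.
Qed.

Lemma open_disc (r : R) (c : R * R) : open (disc r c).
Proof.
apply: (@open_comp _ _ (fun x : R * R => (x.1 - c.1) ^+ 2 + (x.2 - c.2) ^+ 2)
  [set y | y < r ^+ 2]); last exact: open_lt.
move=> x _; apply: cvgD; rewrite expr2; under eq_fun do rewrite expr2.
  by apply: cvgM; (apply: cvgB; [exact: cvg_fst|exact: cvg_cst]).
by apply: cvgM; (apply: cvgB; [exact: cvg_snd|exact: cvg_cst]).
Qed.

(** * Feet of normals and the covering of the annulus by circles *)

Section Tube.
Variables (g1 g2 : R -> R) (L r rho : R).
Hypothesis curve : arclength_simple_closed g1 g2 L.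
Hypothesis r_gt0 : 0 < r.
Hypothesis r_lt_rho : 2 * r < rho.
Hypothesis tubular : tube_ok g1 g2 L rho.

Let L_gt0 : 0 < L. Proof. by case: curve. Qed.

Lemma curve_derive1 (s : R) : is_derive s 1 g1 (derive1 g1 s).
Proof.
by case: curve => _ [H _] _ _ _; move: (H 0%N s); rewrite derive1n0 derive1E => ?; split.
Qed.

Lemma curve_derive2 (s : R) : is_derive s 1 g2 (derive1 g2 s).
Proof.
by case: curve => _ [_ H] _ _ _; move: (H 0%N s); rewrite derive1n0 derive1E => ?; split.
Qed.

Lemma tangent_continuous1 : continuous (derive1 g1).
Proof.
case: curve => _ [H _] _ _ _ s; move: (H 1%N s); rewrite derive1n1 => D.
exact/differentiable_continuous/derivable1_diffP.
Qed.

Lemma tangent_continuous2 : continuous (derive1 g2).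
Proof.
case: curve => _ [_ H] _ _ _ s; move: (H 1%N s); rewrite derive1n1 => D.
exact/differentiable_continuous/derivable1_diffP.
Qed.

Lemma curve_unit_speed s : unitc (tangent (derive1 g1) (derive1 g2) s).
Proof. by case: curve => _ _ _ _ us; exact: us. Qed.

Definition sqdist (x : R * R) (s : R) : R := (x.1 - g1 s) ^+ 2 + (x.2 - g2 s) ^+ 2.

Definition dsqdist (x : R * R) (s : R) : R :=
  - 2 * ((x.1 - g1 s) * derive1 g1 s + (x.2 - g2 s) * derive1 g2 s).

Lemma sqdist_derive x (s : R) : is_derive s 1 (sqdist x) (dsqdist x s).
Proof.
have d1 := is_derive_cstMadd x.1 (-1) (curve_derive1 s).
have d2 := is_derive_cstMadd x.2 (-1) (curve_derive2 s).
have := is_deriveD (is_deriveM d1 d1) (is_deriveM d2 d2).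
have -> : sqdist x = (fun t => x.1 + -1 * g1 t) * (fun t => x.1 + -1 * g1 t) +
   (fun t => x.2 + -1 * g2 t) * (fun t => x.2 + -1 * g2 t).
  apply/funext => t; rewrite /sqdist.
  transitivity ((x.1 + -1 * g1 t) * (x.1 + -1 * g1 t) +
    (x.2 + -1 * g2 t) * (x.2 + -1 * g2 t)) => //; ring.
by move=> H; apply: is_derive_eq H _; rewrite /GRing.scale /= /dsqdist; ring.
Qed.

Lemma sqdist_periodic x : periodic (sqdist x) L.
Proof. by case: curve => _ _ gL _ _ s; rewrite /sqdist; have [-> ->] := gL s. Qed.

(** At a critical point of the distance, [x] minus the curve point is orthogonal to the tangent,
    hence a multiple of the normal; [t] is its inner product with the normal. *)
Lemma critical_tube x s : dsqdist x s = 0 ->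
  exists t, x = tube g1 g2 s t /\ t ^+ 2 = sqdist x s.
Proof.
move=> /eqP; rewrite mulf_eq0 oppr_eq0 pnatr_eq0 /= => /eqP.
rewrite /sqdist; have := curve_unit_speed s; rewrite /unitc /tangent /=.
case: x => a b /=; set u := derive1 g1 s; set v := derive1 g2 s => uv A0.
exists ((b - g2 s) * u - (a - g1 s) * v); split.
  apply/pair_equal_spec; split; rewrite -/u -/v; apply/subr0_eq.
    transitivity ((a - g1 s) * (1 - (u ^+ 2 + v ^+ 2)) + u * ((a - g1 s) * u + (b - g2 s) * v)).
      by ring.
    by rewrite A0 uv subrr !mulr0 addr0.
  transitivity ((b - g2 s) * (1 - (u ^+ 2 + v ^+ 2)) + v * ((a - g1 s) * u + (b - g2 s) * v)).
    by ring.
  by rewrite A0 uv subrr !mulr0 addr0.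
transitivity (((a - g1 s) ^+ 2 + (b - g2 s) ^+ 2) * (u ^+ 2 + v ^+ 2) -
  ((a - g1 s) * u + (b - g2 s) * v) ^+ 2); first by ring.
by rewrite A0 uv mulr1 expr0n subr0.
Qed.

Lemma sqr_lt_norm (t a : R) : 0 < a -> t ^+ 2 < a ^+ 2 -> `|t| < a.
Proof.
by move=> a0; rewrite -[t ^+ 2]real_normK ?num_real // ltr_pXn2r // ?nnegrE ?normr_ge0 // ltW.
Qed.

(** A nearest point of the curve is the foot of a normal through [x], which gives the converse. The
    description by discs yields openness and the domains of integration. *)
Lemma OmegaP x : Omega g1 g2 r x <-> exists s, disc r (g1 s, g2 s) x.
Proof.
split=> [[s [t [tr ->]]]|[s xs]].
  exists s; rewrite /disc /tube /=.
  have -> : forall u v : R, (g1 s - t * v - g1 s) ^+ 2 + (g2 s + t * u - g2 s) ^+ 2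
      = (u ^+ 2 + v ^+ 2) * t ^+ 2 by move=> u v; ring.
  rewrite [_ ^+ 2 + _](curve_unit_speed s) mul1r -[t ^+ 2]real_normK ?num_real //.
  by rewrite ltr_pXn2r // ?nnegrE ?normr_ge0 // ltW.
have [s1 [_ s1min ds1]] := periodic_min L_gt0 (sqdist_periodic x) (sqdist_derive x).
have [t [xE tE]] := critical_tube ds1.
exists s1, t; split => //; apply: sqr_lt_norm => //.
by rewrite tE; apply: le_lt_trans (s1min s) _.
Qed.

Lemma open_Omega : open (Omega g1 g2 r).
Proof.
have -> : Omega g1 g2 r = \bigcup_s disc r (g1 s, g2 s).
  by apply/seteqP; split => x; [move=> /OmegaP [s xs]; exists s
    |move=> [s _ xs]; apply/OmegaP; exists s].
by apply: bigcup_open => s _; exact: open_disc.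
Qed.

Lemma circle_Omega_bar s w : unitc w -> Omega_bar g1 g2 r (circle_pt g1 g2 r s w).
Proof.
move=> w1; exists s; rewrite /circ /circle_pt /=.
by rewrite -[RHS]mulr1 -w1; ring.
Qed.

(** Outside the annulus no curve point is closer than [r], so [s] would minimise the distance; its
    derivative would then vanish, against transversality. *)
Lemma transverse_Omega s w : unitc w ->
  transverse (derive1 g1) (derive1 g2) s w -> Omega g1 g2 r (circle_pt g1 g2 r s w).
Proof.
move=> w1 sw; set x := circle_pt _ _ _ _ _; apply/OmegaP; apply: contrapT => H.
have xs : sqdist x s = r ^+ 2.
  by rewrite /sqdist /x /=; rewrite -[RHS]mulr1 -w1; ring.
have ge_r u : sqdist x s <= sqdist x u.
  by rewrite leNgt; apply/negP => ux; apply: H; exists u; rewrite /disc /= -xs.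
have := @derive1_at_min R (sqdist x) (s - 1) (s + 1) s.
have -> : s - 1 <= s + 1 by rewrite lerD2l; lra.
have -> : s \in `]s - 1, s + 1[ by rewrite in_itv /=; apply/andP; split; lra.
move=> /(_ isT) E.
have [||_] := E _ isT; [by move=> t _; case: (sqdist_derive x t)|by move=> t _|].
case: (sqdist_derive x s) => _ -> /eqP; apply/negP.
rewrite /dsqdist /x /= (_ : _ * _ = - 2 * r * (Re w * derive1 g1 s + Im w * derive1 g2 s)).
  apply: mulf_neq0 => //; apply: mulf_neq0; last by rewrite gt_eqF.
  by rewrite oppr_eq0 pnatr_eq0.
ring.
Qed.

(* The nearest and the farthest point of the curve from x are both feet of
   normals through x; if both were closer than r, they would coincide by
   injectivity of the tube map, and the curve would lie on a circle around x. *)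
Lemma Omega_transverse x : Omega g1 g2 r x -> exists s w,
  [/\ unitc w, transverse (derive1 g1) (derive1 g2) s w & x = circle_pt g1 g2 r s w].
Proof.
move=> /OmegaP [s0 xs0]; have [inj _] := tubular.
have r_rho : r < rho by apply: lt_trans r_lt_rho; rewrite mulr_natl mulr2n ltrDl.
have [s1 [s1I s1min ds1]] := periodic_min L_gt0 (sqdist_periodic x) (sqdist_derive x).
have [s2 [s2I s2max ds2]] := periodic_max L_gt0 (sqdist_periodic x) (sqdist_derive x).
have s1r : sqdist x s1 < r ^+ 2 by apply: le_lt_trans (s1min s0) _.
have [t1 [x1 t1E]] := critical_tube ds1.
have t1r : `|t1| < r by apply: sqr_lt_norm => //; rewrite t1E.
have s2r : r ^+ 2 <= sqdist x s2.
  rewrite leNgt; apply/negP => s2r.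
  have [t2 [x2 t2E]] := critical_tube ds2.
  have t2r : `|t2| < r by apply: sqr_lt_norm => //; rewrite t2E.
  have [s12 _] : s1 = s2 /\ t1 = t2.
    by apply: inj => //; [exact: lt_trans r_rho|exact: lt_trans r_rho|rewrite -x1].
  have sqdist_cst u : sqdist x u = sqdist x s1.
    by apply/eqP; rewrite eq_le s1min andbT s12.
  have d0 u : dsqdist x u = 0.
    case: (sqdist_derive x u) => _ <-.
    have -> : sqdist x = cst (sqdist x s1) by apply/funext.
    exact: derive_cst.
  have tc u : exists t, x = tube g1 g2 u t /\ `|t| < rho.
    have [t [xt tE]] := critical_tube (d0 u); exists t; split => //.
    by apply: lt_trans r_rho; apply: sqr_lt_norm => //; rewrite tE sqdist_cst.
  (* Two different parameters in one period whose normals both reach [x] contradict injectivity. *)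
  have [a [xa ar]] := tc 0; have [b [xb br]] := tc (L / 2).
  have [] : 0 = L / 2 /\ a = b.
    apply: inj => //; first by rewrite lexx L_gt0.
      by rewrite divr_ge0 ?ltW //= ltr_pdivrMr // mulr_natr mulr2n ltrDl.
    by rewrite -xa.
  by move/eqP; rewrite lt_eqF // divr_gt0.
(* Intermediate values between the nearest and the farthest point, staying within one period so that
   injectivity applies. *)
have [s sI sr] : exists2 s, 0 <= s < L & sqdist x s = r ^+ 2.
  have wc a b : {within `[a, b], continuous (sqdist x)}.
    by apply: derivable_within_continuous => u _; case: (sqdist_derive x u).
  move: s1I s2I => /andP[s10 s1L] /andP[s20 s2L].
  have [s12|s21] := leP s1 s2.
    have [|s] := @IVT R (sqdist x) s1 s2 (r ^+ 2) s12 (wc _ _).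
      by rewrite ge_min le_max (ltW s1r) s2r orbT.
    rewrite in_itv /= => /andP[ss1 ss2] E; exists s => //.
    by rewrite (le_trans s10) //= (le_lt_trans ss2).
  have [|s] := @IVT R (sqdist x) s2 s1 (r ^+ 2) (ltW s21) (wc _ _).
    by rewrite ge_min le_max (ltW s1r) s2r orbT.
  rewrite in_itv /= => /andP[ss2 ss1] E; exists s => //.
  by rewrite (le_trans s20) //= (le_lt_trans ss1).
exists s, ((x.1 - g1 s) / r +i* ((x.2 - g2 s) / r))%C.
have rN0 : r != 0 by rewrite gt_eqF.
split.
- rewrite /unitc /= !expr_div_n -mulrDl [_ + _]sr divff // expf_neq0 //.
(* Otherwise [x] would have a normal coordinate of size [r] over [s] and one of size below [r] over
   [s1], both within the injective tube. *)
- rewrite /transverse /=; apply/eqP => A0.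
  have : dsqdist x s = 0.
    rewrite /dsqdist (_ : _ * _ = - 2 * r * ((x.1 - g1 s) / r * derive1 g1 s +
      (x.2 - g2 s) / r * derive1 g2 s)); first by rewrite A0 mulr0.
    by field.
  move=> /critical_tube [t [xt tE]].
  have tr : `|t| = r.
    apply/eqP; rewrite -(@eqrXn2 _ 2) ?normr_ge0 ?ltW // real_normK ?num_real //.
    by rewrite tE sr.
  have [_ tt] : s1 = s /\ t1 = t.
    by apply: inj => //; [exact: lt_trans r_rho|rewrite tr|rewrite -x1].
  by move: t1r; rewrite tt tr ltxx.
rewrite /circle_pt /=; case: (x) => a b /=; apply/pair_equal_spec.
by split; field.
Qed.

Lemma Omega_sub_bar : Omega g1 g2 r `<=` Omega_bar g1 g2 r.
Proof. by move=> x /Omega_transverse [s [w [w1 _ ->]]]; exact: circle_Omega_bar. Qed.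

End Tube.
End Geometry.

(** * Patching and extension to the closure *)

Section Patching.
Variable R : realType.

(** In each coordinate the two bounds [r / 4] add up to [r / 2], and two squares of [r / 2] sum to
    half of [r ^+ 2]. *)
Lemma disc_near (r : R) (c c' x : R * R) : 0 < r ->
  `|c.1 - c'.1| <= r / 4 -> `|c.2 - c'.2| <= r / 4 ->
  `|x.1 - c.1| < r / 4 -> `|x.2 - c.2| < r / 4 -> disc r c' x.
Proof.
move=> r0 c1 c2 x1 x2.
have half (u v w : R) : `|v - w| <= r / 4 -> `|u - v| < r / 4 -> (u - w) ^+ 2 < (r / 2) ^+ 2.
  move=> vw uv; rewrite -[(u - w) ^+ 2]real_normK ?num_real //.
  rewrite ltr_pXn2r // ?nnegrE ?normr_ge0 ?divr_ge0 ?ltW //.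
  apply: le_lt_trans (ler_distD v _ _) _.
  have -> : r / 2 = r / 4 + r / 4 by field.
  exact: ltr_leD.
have := ltrD (half _ _ _ c1 x1) (half _ _ _ c2 x2); rewrite /disc /= => H.
apply: lt_trans H _; have : 0 < r ^+ 2 by rewrite exprn_gt0.
by rewrite expr_div_n; lra.
Qed.

Lemma unit_speed_lipschitz (g dg : R -> R) :
  (forall s : R, is_derive s 1 g (dg s)) -> (forall s, `|dg s| <= 1) ->
  forall a b, `|g b - g a| <= `|b - a|.
Proof.
move=> gd dg1 a b; have [c [_ ->]] := @mean_value_center R g dg a b (fun s _ => gd s).
by rewrite normrM ler_piMl.
Qed.

(** Parameters at most [r / 4] apart have discs sharing a box, so their polynomials agree
    everywhere; any [s] is reached from 0 by [m] equal steps of at most that length. *)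
Lemma poly2_patch (r : R) (g1 g2 : R -> R) (P : R -> R -> R -> R) (F : R * R -> R) n :
  0 < r ->
  (forall a b, `|g1 b - g1 a| <= `|b - a|) ->
  (forall a b, `|g2 b - g2 a| <= `|b - a|) ->
  (forall s, poly2_lt n (P s)) ->
  (forall s x, disc r (g1 s, g2 s) x -> F x = P s x.1 x.2) ->
  forall s x y, P s x y = P 0 x y.
Proof.
move=> r0 lip1 lip2 Pn PF.
have r4 : 0 < r / 4 by rewrite divr_gt0.
have close s u : `|u - s| <= r / 4 -> forall x y, P u x y = P s x y.
  move=> us x y; apply/subr0_eq; move: x y.
  apply: (@poly2_lt_eq0 R n (fun x y => P u x y - P s x y) (g1 s) (g2 s) (r / 4)) => //.
    by apply: poly2_ltD => //; exact: poly2_ltN.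
  move=> x y xs ys; rewrite -(PF u (x, y)) -?(PF s (x, y)) ?subrr //.
    apply: (@disc_near r (g1 s, g2 s)) => //=; rewrite ?subrr ?normr0 ?ltW //.
  apply: (@disc_near r (g1 s, g2 s)) => //=.
    by apply: le_trans (lip1 _ _) _; rewrite distrC.
  by apply: le_trans (lip2 _ _) _; rewrite distrC.
move=> s x y.
have [m mE] : exists m : nat, `|s| / (r / 4) < m%:R.
  by exists (Num.truncn (`|s| / (r / 4))).+1; rewrite truncnS_gt.
have m0 : 0 < m%:R :> R by apply: le_lt_trans mE; rewrite divr_ge0 // ltW.
have step k : P (k%:R * (s / m%:R)) x y = P 0 x y.
  elim: k => [|k <-]; first by rewrite mul0r.
  apply: close; rewrite -mulrBl -natrB // subSnn mul1r normrM normfV.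
  rewrite (gtr0_norm m0) ler_pdivrMr // mulrC -ler_pdivrMr //; exact: ltW.
by rewrite -(step m) mulrCA divff ?mulr1 // gt_eqF.
Qed.

Lemma poly2_lt_line n (P : R -> R -> R) (a b u v : R) : poly2_lt n P ->
  exists p : {poly R}, forall t, P (a + t * u) (b + t * v) = p.[t].
Proof.
move=> [c Pc]; exists (\sum_(i < n) \sum_(j < n | (i + j < n)%N)
  c i j *: ((a%:P + u *: 'X) ^+ i * (b%:P + v *: 'X) ^+ j)) => t.
rewrite Pc horner_sum; apply: eq_bigr => i _; rewrite horner_sum.
apply: eq_bigr => j _; rewrite hornerZ hornerM !horner_exp !hornerD !hornerZ.
by rewrite !hornerC hornerX mulrA [u * t]mulrC [v * t]mulrC.
Qed.

Lemma horner_cvg (p : {poly R}) (a : R) : p.[t] @[t --> a] --> p.[a].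
Proof.
elim/poly_ind: p => [|p c IH].
  by under eq_fun do rewrite horner0; rewrite horner0; exact: cvg_cst.
under eq_fun do rewrite hornerMXaddC; rewrite hornerMXaddC.
by apply: cvgD; [apply: cvgM IH _; exact: cvg_id|exact: cvg_cst].
Qed.

(** The point is approached along its radius, which stays inside the disc; there [P] becomes a
    one-variable polynomial, and both limits agree. *)
Lemma poly2_extend_circle (r : R) (c x : R * R) (K : set (R * R)) n P (F : R * R -> R) :
  0 < r -> poly2_lt n P -> {within K, continuous F} ->
  disc r c `<=` K -> (forall y, disc r c y -> F y = P y.1 y.2) ->
  K x -> (x.1 - c.1) ^+ 2 + (x.2 - c.2) ^+ 2 = r ^+ 2 ->
  F x = P x.1 x.2.
Proof.
move=> r0 Pn /subspace_continuousP Fc cK FP Kx xr.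
have [p pE] := poly2_lt_line c.1 c.2 (x.1 - c.1) (x.2 - c.2) Pn.
pose y t := (c.1 + t * (x.1 - c.1), c.2 + t * (x.2 - c.2)).
have y1 : y 1 = x by rewrite /y !mul1r !subrKC -surjective_pairing.
have yc : y t @[t --> 1^'-] --> x.
  have lin (a u : R) : a + t * u @[t --> 1^'-] --> a + 1 * u.
    apply: cvg_at_left_filter; apply: cvgD; first exact: cvg_cst.
    by apply: cvgM; [exact: cvg_id|exact: cvg_cst].
  rewrite -[x in _ --> x]y1; exact: cvg_pair (lin _ _) (lin _ _).
have yD : \forall t \near 1^'-, disc r c (y t).
  near=> t.
  have t0 : 0 < t by near: t; apply: nbhs_left_gt.
  have t1 : t < 1 by near: t; apply: nbhs_left_lt.
  rewrite /disc /y /=.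
  rewrite (_ : _ + _ = t ^+ 2 * ((x.1 - c.1) ^+ 2 + (x.2 - c.2) ^+ 2)); last by ring.
  by rewrite xr gtr_pMl ?exprn_gt0 // expr_lt1 // ltW.
have Fy : F (y t) @[t --> 1^'-] --> F x.
  move=> A /(Fc x Kx) H; have := yc _ H.
  by apply: filterS2 yD => t /cK Kt; apply.
have py : p.[t] @[t --> 1^'-] --> p.[1] by apply: cvg_at_left_filter; exact: horner_cvg.
have <- : p.[1] = P x.1 x.2 by rewrite -pE !mul1r !subrKC.
apply: (cvg_unique (@norm_hausdorff R R) Fy).
apply: cvg_trans py; apply: near_eq_cvg.
by apply: filterS yD => t /FP ->; rewrite -pE.
Unshelve. all: by end_near. Qed.

End Patching.

Theorem theorem2p4 (R : realType) (g1 g2 : R -> R) (L r : R) (N : nat)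
    (F : R * R -> R) :
  arclength_simple_closed g1 g2 L ->
  0 < r ->
  (exists rho : R, 2 * r < rho /\ tube_ok g1 g2 L rho) ->
  smooth_upto (Omega g1 g2 r) (Omega_bar g1 g2 r) F ->
  (forall s : R, exists P : R -> R -> R,
      poly2_le N P /\ forall x, circ g1 g2 r s x -> F x = P x.1 x.2) ->
  exists P : R -> R -> R,
    poly2_le (2 * N) P /\ forall x, Omega_bar g1 g2 r x -> F x = P x.1 x.2.
Proof.
move=> curve r0 [rho [r_rho tub]] sF FP.
have oO := open_Omega curve r0.
have OK := Omega_sub_bar curve r0 r_rho tub.
have circle_K s w : unitc w -> Omega_bar g1 g2 r (circle_pt g1 g2 r s w).
  exact: circle_Omega_bar.
have hp : circle_poly g1 g2 (derive1 g1) (derive1 g2) r (F, fun=> 0) N 0 (2 * N).+1.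
  apply: (circle_poly_of_poly2 _ _ r0) => s; have [P [PN PE]] := FP s.
  exists P; split => // w w1; apply: PE.
  by rewrite /circ /circle_pt /= -[RHS]mulr1 -w1; ring.
have F_tame := smooth_upto_tame oO OK sF.
(* The imaginary part of [F]; its tameness comes from writing it as [0 * F + 0 * F]. *)
have zero_tame n : tame (Omega g1 g2 r) (Omega_bar g1 g2 r) n (fun=> 0).
  have := tame_lin 0 0 (F_tame n) (F_tame n).
  by under eq_fun do rewrite !mul0r addr0.
have disc_O s : disc r (g1 s, g2 s) `<=` Omega g1 g2 r.
  by move=> x xs; apply/(OmegaP curve r0); exists s.
have /choice [P PP] s : exists P, poly2_lt (2 * N).+1 P /\
    forall x, disc r (g1 s, g2 s) x -> F x = P x.1 x.2.
  have [P [P2 [PN _ PE]]] := circle_poly_local r0 (curve_derive1 curve)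
    (curve_derive2 curve) (tangent_continuous1 curve) (tangent_continuous2 curve)
    (curve_unit_speed curve) oO (transverse_Omega curve r0) circle_K
    (Omega_transverse curve r0 r_rho tub)
    (h := (F, fun=> 0)) (F_tame _) (zero_tame _) hp (disc_O s).
  by exists P; split => // x /PE [].
have dg_le1 (u v : R) : u ^+ 2 + v ^+ 2 = 1 -> `|u| <= 1 /\ `|v| <= 1.
  move=> uv; split; rewrite -(@expr_le1 _ 2) // real_normK ?num_real // -uv.
    by rewrite lerDl sqr_ge0.
  by rewrite lerDr sqr_ge0.
have P0 := poly2_patch r0
  (unit_speed_lipschitz (curve_derive1 curve)
    (fun s => (dg_le1 _ _ (curve_unit_speed curve s)).1))
  (unit_speed_lipschitz (curve_derive2 curve)
    (fun s => (dg_le1 _ _ (curve_unit_speed curve s)).2))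
  (fun s => (PP s).1) (fun s => (PP s).2).
(* [poly2_lt (2 * N).+1] and [poly2_le (2 * N)] are convertible. *)
exists (P 0); split; first exact: (PP 0).1.
move=> x Kx; have [s xs] := Kx; rewrite -(P0 s).
apply: (poly2_extend_circle r0 (PP s).1 sF.1 _ (PP s).2) => //.
exact: subset_trans (disc_O s) OK.
Qed.
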